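(* Let $\mathbb{K}\in\{\mathbb{C},\mathbb{H}\}$, let $B$ be a compact manifold, let $\varphi:B\to\mathbb{KP}^{N-1}$ be an immersion, and endow $B$ with the pull-back metric. Let $\nabla$ be the connection on the $\mathbb{K}^1$-vector bundle $E\to B$ obtained by pulling back, via $\varphi$, the universal connection in the universal $\mathbb{K}^1$-bundle over $\mathbb{KP}^{N-1}$. Consider the inequalities $$\text{(A)}\quad \langle (D_XR^\nabla)(X,Y)W,V\rangle^2 \leq k_B(X,Y)\cdot |R^\nabla(W,V)X|^2,$$ $$\text{(B)}\quad \langle S_{(\mathfrak{J}X)^\perp}Y - S_{(\mathfrak{J}Y)^\perp}X,\,X\rangle^2\leq k_B(X,Y)\cdot|\mathrm{proj}(\mathfrak{J}X)|^2.$$ Then (A) holds for all $p\in B$, all $X,Y\in T_pB$ and all $W,V\in E_p$ if and only if (B) holds for all $p\in B$, all $X,Y\in T_pB\cong\varphi_*(T_pB)$ and all $\mathfrak{J}\in\mathrm{span}\{\mathcal{J}\}$. Further, (A) holds with strict inequality for all $p\in B$, all orthonormal $X,Y\in T_pB$ and all orthonormal $W,V\in E_p$ if and only if (B) holds with strict inequality for all $p\in B$, all orthonormal $X,Y\in T_pB$ and all unit-length $\mathfrak{J}\in\mathrm{span}\{\mathcal{J}\}$.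
   Context: Universal bundle and connection: $\mathbb{KP}^{N-1}$ is the Grassmannian of $1$-dimensional $\mathbb{K}$-linear subspaces of $\mathbb{K}^N$, with its standard metric (Fubini–Study, respectively its quaternionic analogue, up to scale). The universal vector bundle over it has total space $\{(\sigma,V)\mid \sigma\in\mathbb{KP}^{N-1},\ V\in\sigma\}$ and projection $(\sigma,V)\mapsto\sigma$. The universal connection is the one for which the covariant derivative of a section $t\mapsto(\sigma(t),V(t))$ along a curve is $t\mapsto(\sigma(t),V'(t)^{\sigma(t)})$, where the superscript denotes orthogonal projection onto $\sigma(t)$. The fibers $E_p$ carry the real inner product inherited from $\mathbb{K}^N$; orthonormality in $E_p$ is with respect to this real inner product. $R^\nabla$ is the curvature tensor of $\nabla$, and $DR^\nabla$ is its covariant derivative (using $\nabla$ and the Levi-Civita connection of $B$). For $W,V\in E_p$ and $X\in T_pB$, $R^\nabla(W,V)X\in T_pB$ is defined by $\langle R^\nabla(W,V)X,Z\rangle=\langle R^\nabla(X,Z)W,V\rangle$ for all $Z\in T_pB$. $k_B(X,Y)$ is the unnormalized sectional curvature of $B$, i.e. $\langle R_B(X,Y)Y,X\rangle$, which equals the sectional curvature when $X,Y$ are orthonormal. $\mathcal{J}=\{J\}$ if $\mathbb{K}=\mathbb{C}$, where $J$ is the standard almost complex structure on $\mathbb{CP}^{N-1}$; $\mathcal{J}=\{I,J,K\}$ if $\mathbb{K}=\mathbb{H}$, where $\{I,J,K\}$ is a local basis for the standard almost quaternionic structure on $\mathbb{HP}^{N-1}$. The span is the real span, with the inner product making the elements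 of $\mathcal{J}$ orthonormal. $II$ is the second fundamental form of $\varphi(B)$ and $S$ is the shape operator: $\langle S_\eta X,Y\rangle=\langle II(X,Y),\eta\rangle$ for $X,Y\in T_pB\cong\varphi_*(T_pB)$, $\eta\perp\varphi_*(T_pB)$. The superscript $\perp$ denotes the component orthogonal to $\varphi_*(T_pB)$, and $\mathrm{proj}$ denotes orthogonal projection onto $\varphi_*(T_pB)$. *)

(* Defs.v *)
From HB Require Import structures.
From mathcomp Require Import all_boot all_order all_algebra.
From mathcomp Require Import all_classical all_reals all_analysis.
From mathcomp.real_closed Require Import complex.

Set Implicit Arguments.
Unset Strict Implicit.
Unset Printing Implicit Defensive.

Import Order.TTheory GRing.Theory Num.Theory.
Import numFieldNormedType.Exports.

Local Open Scope classical_set_scope.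
Local Open Scope ring_scope.

(** * The scalars C and H

  A scalar is the row of its real coordinates in the basis (1, i) of C, resp.
  (1, i, j, k) of H; a vector of K^N is the N x (dim_R K) matrix of the
  coordinates of its entries. In this way K^N is a real normed space, and its
  real inner product is the Euclidean one. *)

Variant scalars := Complexes | Quaternions.

Definition nimag (K : scalars) : nat :=
  match K with Complexes => 1 | Quaternions => 3 end.

Notation dimK K := (nimag K).+1.

Section Scalars.
Context {R : realType}.

Definition cmul (x y : 'rV[R]_2) : 'rV[R]_2 :=
  let: (a +i* b)%C :=
    ((x 0 (inord 0) +i* x 0 (inord 1)) * (y 0 (inord 0) +i* y 0 (inord 1)))%C in
  \row_l [:: a; b]`_l.

Definition hmul (x y : 'rV[R]_4) : 'rV[R]_4 :=
  let x0 := x 0 (inord 0) in let x1 := x 0 (inord 1) in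
  let x2 := x 0 (inord 2) in let x3 := x 0 (inord 3) in
  let y0 := y 0 (inord 0) in let y1 := y 0 (inord 1) in
  let y2 := y 0 (inord 2) in let y3 := y 0 (inord 3) in
  \row_l [:: x0 * y0 - x1 * y1 - x2 * y2 - x3 * y3;
             x0 * y1 + x1 * y0 + x2 * y3 - x3 * y2;
             x0 * y2 - x1 * y3 + x2 * y0 + x3 * y1;
             x0 * y3 + x1 * y2 - x2 * y1 + x3 * y0]`_l.

Definition kmul (K : scalars) :
    'rV[R]_(dimK K) -> 'rV[R]_(dimK K) -> 'rV[R]_(dimK K) :=
  match K with Complexes => cmul | Quaternions => hmul end.

Definition kone (K : scalars) : 'rV[R]_(dimK K) := delta_mx 0 ord0.

(** i for C; i, j, k for H. *)
Definition kunit (K : scalars) (s : 'I_(nimag K)) : 'rV[R]_(dimK K) :=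
  delta_mx 0 (lift ord0 s).

(** K acts on K^N on the right. *)
Definition kscale (K : scalars) (N : nat) (v : 'M[R]_(N, dimK K))
    (a : 'rV[R]_(dimK K)) : 'M[R]_(N, dimK K) :=
  \matrix_i kmul (row i v) a.

Definition kline (K : scalars) (N : nat) (v : 'M[R]_(N, dimK K)) :
    set 'M[R]_(N, dimK K) :=
  range (kscale v).

Definition mxdot (m n : nat) (u v : 'M[R]_(m, n)) : R := \tr (u *m v^T).

Definition orthproj (m n : nat) (L : set 'M[R]_(m, n)) (w : 'M[R]_(m, n)) :
    'M[R]_(m, n) :=
  xget 0 [set v | L v /\ forall u, L u -> mxdot (w - v) u = 0].

Definition orthonormal_pair (V : Type) (form : V -> V -> R) (x y : V) : Prop :=
  [/\ form x x = 1, form y y = 1 & form x y = 0].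

End Scalars.

Arguments mxdot {R m n} u v.

(** * Smooth manifolds *)

Section Manifolds.
Context {R : realType}.

(** On an open set [U], being C^k for all [k]. *)
Fixpoint class_C (k n : nat) (W : normedModType R) (U : set 'rV[R]_n)
    (f : 'rV[R]_n -> W) : Prop :=
  match k with
  | 0 => forall x, U x -> {for x, continuous f}
  | k'.+1 => (forall x, U x -> differentiable f x) /\
             forall v, class_C k' U ('D_v f)
  end.

Definition smooth_on (n : nat) (W : normedModType R) (U : set 'rV[R]_n)
    (f : 'rV[R]_n -> W) : Prop :=
  forall k, class_C k U f.

(** [cmap] and [cinv] are only relevant on [cdom] and [cmap @` cdom]. *)
Record chart (n : nat) (B : topologicalType) := Chart {
  cdom : set B;
  cmap : B -> 'rV[R]_n;
  cinv : 'rV[R]_n -> B;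
  cdom_open : open cdom;
  cimg_open : open (cmap @` cdom);
  cmapK : forall p, cdom p -> cinv (cmap p) = p;
  cmap_continuous : forall p, cdom p -> {for p, continuous cmap};
  cinv_continuous :
    forall y, (cmap @` cdom) y -> {for y, continuous cinv} }.

Definition smooth_atlas (n : nat) (B : topologicalType)
    (A : set (chart n B)) : Prop :=
  \bigcup_(x in A) cdom x = setT /\
  forall x y, A x -> A y ->
    smooth_on (cmap x @` (cdom x `&` cdom y)) (cmap y \o cinv x).

Definition compact_manifold (n : nat) (B : topologicalType)
    (A : set (chart n B)) : Prop :=
  [/\ hausdorff_space B, @second_countable B, smooth_atlas A
    & compact [set: B]].

End Manifolds.

Arguments chart : clear implicits.

(** * Riemannian geometry in coordinates

  [G y X Y] is the inner product of the tangent vectors [X] and [Y] at [y], in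
  coordinates. A fixed vector is also regarded as the vector field with these
  constant coordinates; such fields commute. *)

Section RiemannianCoordinates.
Context {R : realType}.

(** The Christoffel term [nabla_X Y] of the Levi-Civita connection, given by the
  Koszul formula. *)
Definition christoffel (n : nat) (G : 'rV[R]_n -> 'rV[R]_n -> 'rV[R]_n -> R)
    (y X Y : 'rV[R]_n) : 'rV[R]_n :=
  xget 0 [set T | forall Z : 'rV[R]_n,
    2 * G y T Z = 'D_X (fun z => G z Y Z : R^o) y
                + 'D_Y (fun z => G z X Z : R^o) y
                - 'D_Z (fun z => G z X Y : R^o) y].

Definition levi_civita (n : nat) (G : 'rV[R]_n -> 'rV[R]_n -> 'rV[R]_n -> R)
    (X : 'rV[R]_n) (F : 'rV[R]_n -> 'rV[R]_n) (y : 'rV[R]_n) : 'rV[R]_n :=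
  'D_X F y + christoffel G y X (F y).

Definition riemann (n : nat) (G : 'rV[R]_n -> 'rV[R]_n -> 'rV[R]_n -> R)
    (y X Y Z : 'rV[R]_n) : 'rV[R]_n :=
  levi_civita G X (levi_civita G Y (cst Z)) y
  - levi_civita G Y (levi_civita G X (cst Z)) y.

Definition sectional (n : nat) (G : 'rV[R]_n -> 'rV[R]_n -> 'rV[R]_n -> R)
    (y X Y : 'rV[R]_n) : R :=
  G y (riemann G y X Y Y) X.

Section Submanifold.
Variables (n m : nat) (H : 'rV[R]_m -> 'rV[R]_m -> 'rV[R]_m -> R).
Variable (f : 'rV[R]_n -> 'rV[R]_m).

Definition pullback_metric (y X Y : 'rV[R]_n) : R :=
  H (f y) ('D_X f y) ('D_Y f y).

Definition tanproj (y : 'rV[R]_n) (xi : 'rV[R]_m) : 'rV[R]_m :=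
  xget 0 [set zeta | (exists X, zeta = 'D_X f y) /\
                     forall X, H (f y) (xi - zeta) ('D_X f y) = 0].

Definition norproj (y : 'rV[R]_n) (xi : 'rV[R]_m) : 'rV[R]_m :=
  xi - tanproj y xi.

(** The derivative along [X] of the field ['D_Y f] along [f], for the
  Levi-Civita connection of [H]. *)
Definition ambient_derivative (y X Y : 'rV[R]_n) : 'rV[R]_m :=
  'D_X ('D_Y f) y + christoffel H (f y) ('D_X f y) ('D_Y f y).

Definition second_fundamental_form (y X Y : 'rV[R]_n) : 'rV[R]_m :=
  norproj y (ambient_derivative y X Y).

Definition shape_operator (y : 'rV[R]_n) (eta : 'rV[R]_m) (X : 'rV[R]_n) :
    'rV[R]_n :=
  xget 0 [set T | forall Y, pullback_metric y T Y =
                            H (f y) (second_fundamental_form y X Y) eta].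

End Submanifold.
End RiemannianCoordinates.

(** * Line bundles with the connection obtained by orthogonal projection

  [E y] is the fiber at [y], a subspace of a fixed Euclidean space; sections are
  functions [s] with [s y] in [E y]. *)

Section ProjectedConnection.
Context {R : realType} {n N d : nat}.
Variable (E : 'rV[R]_n -> set 'M[R]_(N, d)).

Definition nabla (X : 'rV[R]_n) (s : 'rV[R]_n -> 'M[R]_(N, d))
    (y : 'rV[R]_n) : 'M[R]_(N, d) :=
  orthproj (E y) ('D_X s y).

Definition curvature (X Y : 'rV[R]_n) (s : 'rV[R]_n -> 'M[R]_(N, d))
    (y : 'rV[R]_n) : 'M[R]_(N, d) :=
  nabla X (nabla Y s) y - nabla Y (nabla X s) y.

(** A section through [W]. The tensors below do not depend on its choice. *)
Definition extension (W : 'M[R]_(N, d)) (y : 'rV[R]_n) : 'M[R]_(N, d) :=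
  orthproj (E y) W.

Definition curvature_tensor (y X Y : 'rV[R]_n) (W : 'M[R]_(N, d)) :
    'M[R]_(N, d) :=
  curvature X Y (extension W) y.

Variable (G : 'rV[R]_n -> 'rV[R]_n -> 'rV[R]_n -> R).

(** [(D_Z R)(X, Y) W] *)
Definition curvature_derivative (y Z X Y : 'rV[R]_n) (W : 'M[R]_(N, d)) :
    'M[R]_(N, d) :=
  let s := extension W in
  nabla Z (curvature X Y s) y
  - curvature (christoffel G y Z X) Y s y
  - curvature X (christoffel G y Z Y) s y
  - curvature X Y (nabla Z s) y.

(** The tangent vector [R(W, V) X], with
  [<R(W, V) X, Z> = <R(X, Z) W, V>] for all [Z]. *)
Definition curvature_dual (y : 'rV[R]_n) (W V : 'M[R]_(N, d))
    (X : 'rV[R]_n) : 'rV[R]_n :=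
  xget 0 [set T | forall Z, G y T Z = mxdot (curvature_tensor y X Z W) V].

End ProjectedConnection.

(** * The projective space of K^N *)

Section ProjectiveSpace.
Context {R : realType} {K : scalars} {N : nat}.

Record KP := MkKP {
  line_of :> set 'M[R]_(N, dimK K);
  line_ofP : exists2 v, v != 0 & line_of = kline v }.

(** Affine charts: for [j : 'I_N], the vector [x] of K^(N-1) corresponds to the
  line spanned by the vector of K^N with entry 1 at [j] and other entries [x]. *)

Definition insert_row (j : 'I_N) (a : 'rV[R]_(dimK K))
    (x : 'rV[R]_(N.-1 * dimK K)) : 'M[R]_(N, dimK K) :=
  \matrix_i if unlift j i is Some i' then row i' (vec_mx x) else a.

Definition affine_dom (j : 'I_N) : set KP :=
  [set sigma | exists2 v, line_of sigma v & row j v = kone K].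

Definition affine_coord (j : 'I_N) (sigma : KP) : 'rV[R]_(N.-1 * dimK K) :=
  mxvec (row' j (xget 0 [set v | line_of sigma v /\ row j v = kone K])).

(** The tangent space at the line [sigma] is Hom_K(sigma, sigma^perp), with
  <A, A'> = <A u, A' u> for any unit vector u of sigma; [scale] is the factor up
  to which this metric is considered. With v the vector of the line having entry 1
  at [j], the coordinate vector [xi] is the homomorphism sending v to the component
  of [insert_row j 0 xi] orthogonal to sigma. *)
Definition fubini_study (scale : R) (j : 'I_N)
    (x xi eta : 'rV[R]_(N.-1 * dimK K)) : R :=
  let v := insert_row j (kone K) x in
  let perp w := w - orthproj (kline v) w in
  scale * mxdot (perp (insert_row j 0 xi)) (perp (insert_row j 0 eta))
  / mxdot v v.

(** In an affine chart, the standard almost complex structure of CP^(N-1) is the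
  multiplication by i of the coordinates. A local basis of the standard almost
  quaternionic structure of HP^(N-1) is given by the multiplications by i, j, k of
  the coordinates, on the right since lines are right subspaces. *)
Definition almost_structure (s : 'I_(nimag K)) (xi : 'rV[R]_(N.-1 * dimK K)) :
    'rV[R]_(N.-1 * dimK K) :=
  mxvec (kscale (vec_mx xi) (kunit s)).

Definition span_structure (a : 'rV[R]_(nimag K))
    (xi : 'rV[R]_(N.-1 * dimK K)) : 'rV[R]_(N.-1 * dimK K) :=
  \sum_s a 0 s *: almost_structure s xi.

End ProjectiveSpace.

Arguments KP : clear implicits.

(** * Immersions into the projective space *)

Section Immersion.
Context {R : realType} {K : scalars} {N n : nat} {B : topologicalType}.
Implicit Types (A : set (chart R n B)) (x : chart R n B) (j : 'I_N).

(** The chart [x] of [B] and the affine chart [j] can be used at [p]. *)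
Definition charts_at A (phi : B -> KP R K N) (p : B) x j : Prop :=
  [/\ A x, cdom x p & affine_dom j (phi p)].

Definition local_map (phi : B -> KP R K N) x j (y : 'rV[R]_n) :
    'rV[R]_(N.-1 * dimK K) :=
  affine_coord j (phi (cinv x y)).

Definition immersion A (phi : B -> KP R K N) : Prop :=
  (forall x j, A x ->
     open (cdom x `&` phi @^-1` affine_dom j) /\
     smooth_on (cmap x @` (cdom x `&` phi @^-1` affine_dom j))
               (local_map phi x j)) /\
  (forall p x j, charts_at A phi p x j ->
     forall X, 'D_X (local_map phi x j) (cmap x p) = 0 -> X = 0).

(** The remaining definitions concern the point [p]; tangent vectors of [B] at [p]
  are given by their coordinates in the chart [x], those of the projective space
  at [phi p] by their coordinates in the affine chart [j]. *)

Variables (scale : R) (phi : B -> KP R K N).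

Definition base_metric x j : 'rV[R]_n -> 'rV[R]_n -> 'rV[R]_n -> R :=
  pullback_metric (fubini_study scale j) (local_map phi x j).

Definition fiber x (y : 'rV[R]_n) : set 'M[R]_(N, dimK K) :=
  line_of (phi (cinv x y)).

(** The two sides of the inequalities (A) and (B). *)

Definition lhs_A (p : B) x j (X Y : 'rV[R]_n) (W V : 'M[R]_(N, dimK K)) : R :=
  let y := cmap x p in
  mxdot (curvature_derivative (fiber x) (base_metric x j) y X X Y W) V ^+ 2.

Definition rhs_A (p : B) x j (X Y : 'rV[R]_n) (W V : 'M[R]_(N, dimK K)) : R :=
  let y := cmap x p in
  let G := base_metric x j in
  let RX := curvature_dual (fiber x) G y W V X in
  sectional G y X Y * G y RX RX.

Definition lhs_B (p : B) x j (X Y : 'rV[R]_n) (a : 'rV[R]_(nimag K)) : R :=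
  let y := cmap x p in
  let H := fubini_study scale j in
  let f := local_map phi x j in
  let JX := span_structure a ('D_X f y) in
  let JY := span_structure a ('D_Y f y) in
  base_metric x j y (shape_operator H f y (norproj H f y JX) Y
                     - shape_operator H f y (norproj H f y JY) X) X ^+ 2.

Definition rhs_B (p : B) x j (X Y : 'rV[R]_n) (a : 'rV[R]_(nimag K)) : R :=
  let y := cmap x p in
  let H := fubini_study scale j in
  let f := local_map phi x j in
  let JX := span_structure a ('D_X f y) in
  sectional (base_metric x j) y X Y
  * H (f y) (tanproj H f y JX) (tanproj H f y JX).

End Immersion.

(* Main.v *)
(** Send a line to the orthogonal projection onto it. In an affine chart of the
  projective space this gives a map [Psi] to the symmetric matrices, and the
  metric is a constant multiple of [tr (D_xi Psi D_eta Psi)]; likewise the metric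
  of [B] is the same multiple of [tr (D_X Phi D_Y Phi)], where [Phi] is [Psi]
  composed with the immersion. Hence both Levi-Civita connections are tangential
  parts of flat derivatives, and [<S_{(J X)^perp} Y, X>] is a multiple of the
  trace pairing of [D_Y D_X Phi - D_Gamma Phi] with [D_(J X) Psi], where [Gamma]
  is the Christoffel term of [X] and [Y].

  The curvature of the projected connection is [Phi [D_X Phi, D_Y Phi] Phi], and
  its covariant derivative is obtained by replacing the first derivatives in turn
  by [D_Z D_X Phi - D_Gamma Phi]. For [W = v a] and [V = v b] on the line of [v],
  the pairing [<[S, D_xi Psi] W, V>] with a symmetric K-linear [S] is a multiple
  of [tr (S D_(xi q) Psi)], where [q] is the imaginary scalar
  [a b^* - b a^*]. So the two sides of (A) for [W, V] are those of (B) for the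
  structure [q], up to one common positive factor, at each point and for each
  [X, Y]. *)

Require Import Defs.
From HB Require Import structures.
From mathcomp Require Import all_boot all_order all_algebra.
From mathcomp Require Import all_classical all_reals all_analysis.
From mathcomp Require Import ring lra.

Set Implicit Arguments.
Unset Strict Implicit.
Unset Printing Implicit Defensive.

Import Order.TTheory GRing.Theory Num.Theory.
Import numFieldNormedType.Exports.
Local Open Scope classical_set_scope.
Local Open Scope ring_scope.

(** * Calculus of matrix-valued maps *)

Section MatrixCalculus.
Context {R : realType} {V : normedModType R}.

Lemma differentiable_mxP m n (M : V -> 'M[R]_(m, n)) t :
  differentiable M t <-> forall i j, differentiable (fun z => M z i j) t.
Proof.
split=> [Mt i j|Mt].
  exact: (differentiable_comp Mt (differentiable_coord (M t) i j)).
have -> : M = (\sum_i \sum_j (fun z => M z i j *: delta_mx i j)).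
  apply/funext => z; rewrite [LHS]matrix_sum_delta fct_sumE.
  by apply: eq_bigr => i _; rewrite fct_sumE.
apply: differentiable_sum => i; apply: differentiable_sum => j.
exact: differentiableZl.
Qed.

Lemma derive_mxE m n (M : V -> 'M[R]_(m, n)) t v i j : differentiable M t ->
  'D_v M t i j = 'D_v (fun z => M z i j) t.
Proof. by move=> Mt; rewrite derive_mx ?mxE//; exact: diff_derivable. Qed.

(** In finite dimension a linear map is a finite combination of coordinate functions with constant
    vector coefficients. *)
Lemma differentiable_linmx m n (W : normedModType R)
    (L : {linear 'M[R]_(m, n) -> W}) M : differentiable L M.
Proof.
have -> : (L : _ -> _) =
    \sum_i \sum_j (fun M : 'M[R]_(m, n) => M i j *: L (delta_mx i j)).
  apply/funext => z; rewrite [in LHS](matrix_sum_delta z) linear_sum fct_sumE.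
  apply: eq_bigr => i _; rewrite linear_sum fct_sumE.
  by apply: eq_bigr => j _; rewrite linearZ.
apply: differentiable_sum => i; apply: differentiable_sum => j.
by apply: differentiableZl; exact: differentiable_coord.
Qed.

Lemma differentiable_linmx_comp m n (W : normedModType R)
    (L : {linear 'M[R]_(m, n) -> W}) (M : V -> 'M[R]_(m, n)) t :
  differentiable M t -> differentiable (fun z => L (M z)) t.
Proof.
by move=> Mt; apply: differentiable_comp Mt _; exact: differentiable_linmx.
Qed.

(** Used to move derivatives through transposition, trace, [mxvec], [vec_mx] and right
    multiplication by a scalar. *)
Lemma derive_linmx m n (W : normedModType R)
    (L : {linear 'M[R]_(m, n) -> W}) (M : V -> 'M[R]_(m, n)) t v :
  differentiable M t -> 'D_v (fun z => L (M z)) t = L ('D_v M t).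
Proof.
move=> Mt; have LM := differentiable_linmx L (M t).
have -> : (fun z => L (M z)) = L \o M by [].
rewrite deriveE; last exact: differentiable_comp.
rewrite (diff_comp Mt LM) /= -(deriveE _ Mt).
rewrite (@diff_lin _ _ _ L)// => z.
exact/differentiable_continuous/differentiable_linmx.
Qed.

Lemma differentiable_mulmx m n p (M : V -> 'M[R]_(m, n)) (N : V -> 'M[R]_(n,
  p)) t :
  differentiable M t -> differentiable N t ->
  differentiable (fun z => M z *m N z) t.
Proof.
move=> /differentiable_mxP Mt /differentiable_mxP Nt.
apply/differentiable_mxP => i j.
have -> : (fun z => (M z *m N z) i j) =
    \sum_k ((fun z => M z i k) * (fun z => N z k j)).
  by apply/funext => z; rewrite mxE fct_sumE.
by apply: differentiable_sum => k; exact: differentiableM.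
Qed.

Lemma derive_mulmx m n p (M : V -> 'M[R]_(m, n)) (N : V -> 'M[R]_(n, p)) t v :
  differentiable M t -> differentiable N t ->
  'D_v (fun z => M z *m N z) t = 'D_v M t *m N t + M t *m 'D_v N t.
Proof.
move=> Mt Nt; apply/matrixP => i j.
rewrite derive_mxE; last exact: differentiable_mulmx.
have -> : (fun z => (M z *m N z) i j) =
    \sum_k ((fun z => M z i k) * (fun z => N z k j)).
  by apply/funext => z; rewrite mxE fct_sumE.
have /differentiable_mxP Mt' := Mt; have /differentiable_mxP Nt' := Nt.
rewrite derive_sum; last first.
  by move=> k; apply: derivableM; exact: diff_derivable.
rewrite !mxE -big_split; apply: eq_bigr => k _ /=.
rewrite deriveM; try exact/diff_derivable; try exact/diff_derivable/Mt'.
by rewrite (derive_mxE _ _ _ Mt) (derive_mxE _ _ _ Nt) addrC; congr (_ + _);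
  rewrite mulrC.
Qed.

End MatrixCalculus.

(** * Symmetry of second derivatives *)

Section Schwarz.
Context {R : realType} {V : normedModType R}.
Implicit Types (f : V -> R) (a y X Y : V).

(** Restriction to a line, where the one-variable mean value theorem is available; the two
    difference quotients are the same function of [h]. *)
Lemma is_derive_along f a X (s : R) : derivable f (s *: X + a) X ->
  is_derive s 1 (fun s : R => f (s *: X + a)) ('D_X f (s *: X + a)).
Proof.
rewrite /derivable => df.
have E : (fun h => h^-1 *: (((fun s : R => f (s *: X + a)) \o shift s) (h *: 1)
                            - f (s *: X + a))) =
         (fun h => h^-1 *: ((f \o shift (s *: X + a)) (h *: X) - f (s *: X +
           a))).
  by apply/funext => h /=; rewrite [h *: 1]mulr1 scalerDl addrA.
by apply: DeriveDef; rewrite /derivable /derive E.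
Qed.

(** The mean value theorem in the direction [X] turns the second difference into a difference of two
    values of ['D_X f], which are then expanded to first order at [y]. *)
Lemma second_difference f y X Y (e : R) : 0 < e ->
  (\forall z \near y, differentiable f z) -> differentiable ('D_X f) y ->
  \forall t \near (0 : R)^'+,
    `|f (y + t *: X + t *: Y) - f (y + t *: X) - f (y + t *: Y) + f y
      - t ^+ 2 * 'D_Y ('D_X f) y| <= e * t ^+ 2.
Proof.
(* The summand 1 keeps [M] positive even when [X] and [Y] vanish. For [s], [u] between 0 and [t] the
   vector [s *: X + u *: Y] has norm at most [t * M], so the tolerance [e / (2 * M)] makes each of
   the two remainders at most [e * t / 2]. *)
move=> e0 fd gd; set M := `|X| + `|Y| + 1.
have M0 : 0 < M by rewrite ltr_wpDl// addr_ge0.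
have e'0 : 0 < e / (2 * M) by rewrite divr_gt0// mulr_gt0.
have := diff_locally gd => /eqaddoP /(_ _ e'0) => gdy.
have {}gdy : \forall h \near (0 : V),
    `|'D_X f (h + y) - ('D_X f y + 'd ('D_X f) y h)| <= e / (2 * M) * `|h|.
  exact: gdy.
have fd' : \forall h \near (0 : V), differentiable f (h + y).
  by move: fd; rewrite (near_shift 0); apply: filterS => h /=; rewrite subr0.
have [d /= d0 dP] := (nbhs_ballP _ _).1 (filterI gdy fd').
near=> t.
have t0 : 0 < t by [].
have tM : t * M < d.
  rewrite -ltr_pdivlMr//; near: t; apply: nbhs_right_lt.
  by rewrite divr_gt0.
have small (s u : R) : 0 <= s <= t -> 0 <= u <= t ->
    `|s *: X + u *: Y| <= t * M.
  move=> /andP[s0 st] /andP[u0 ut].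
  apply: (le_trans (ler_normD _ _)); rewrite !normrZ !ger0_norm// /M !mulrDr.
  by rewrite -[X in X <= _]addr0 !lerD ?ler_wpM2r// mulr1 ltW.
have inball (s u : R) : 0 <= s <= t -> 0 <= u <= t ->
    ball 0 d (s *: X + u *: Y).
  move=> sP uP; rewrite -ball_normE /= sub0r normrN.
  exact: le_lt_trans (small _ _ sP uP) tM.
have t0t : 0 <= t <= t by rewrite lexx ltW.
have o0t : 0 <= (0 : R) <= t by rewrite lexx ltW.
(* The second difference is [phi t - phi 0]. *)
pose phi (s : R) := f (s *: X + (t *: Y + y)) - f (s *: X + y).
have dphi s : 0 <= s <= t ->
   is_derive s 1 phi ('D_X f (s *: X + (t *: Y + y)) - 'D_X f (s *: X + y)).
  move=> sP; apply: is_deriveB; apply: is_derive_along; apply: diff_derivable.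
    by rewrite addrA; case: (dP _ (inball _ _ sP t0t)).
  by case: (dP _ (inball _ _ sP o0t)); rewrite scale0r addr0.
have cphi : {within `[0, t], continuous phi}.
  apply: derivable_within_continuous => s; rewrite in_itv /= => sP.
  by have [] := dphi s sP.
have {}dphi s : s \in `]0, t[%R -> is_derive s 1 phi
    ('D_X f (s *: X + (t *: Y + y)) - 'D_X f (s *: X + y)).
  by rewrite in_itv /= => /andP[s0 st]; apply: dphi; rewrite !ltW.
have [c] := MVT t0 dphi cphi.
rewrite in_itv /= => /andP[/ltW c0 /ltW ct].
have cP : 0 <= c <= t by rewrite c0.
rewrite subr0 => phit.
have lin u s : 'd ('D_X f) y (u *: X + s *: Y) =
    u * 'D_X ('D_X f) y + s * 'D_Y ('D_X f) y.
  by rewrite linearD !linearZ !deriveE.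
have [+ _] := dP _ (inball _ _ cP t0t); rewrite lin.
have [+ _] := dP _ (inball _ _ cP o0t); rewrite lin mul0r.
rewrite scale0r !addr0 -addrA.
have := small _ _ cP t0t; have := small _ _ cP o0t; rewrite scale0r addr0.
have -> : f (y + t *: X + t *: Y) - f (y + t *: X) - f (y + t *: Y) + f y =
    phi t - phi 0.
  rewrite /phi !scale0r !add0r [t *: Y + y]addrC addrCA addrA.
  rewrite [t *: X + y]addrC; lra.
rewrite phit => s1 s2.
set a : R := 'D_X f _; set g : R := 'D_X f y; set b : R := 'D_X f _.
set L1 : R := 'D_X ('D_X f) y; set L2 : R := 'D_Y ('D_X f) y.
move=> r1 r2.
have bnd u : u <= t * M -> e / (2 * M) * u <= e * t / 2.
  move=> uM; rewrite -[X in _ <= X](_ : e / (2 * M) * (t * M) = _).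
    by rewrite ler_pM2l.
  by field; rewrite gt_eqF.
have {}r1 := le_trans r1 (bnd _ s1); have {}r2 := le_trans r2 (bnd _ s2).
(* The value [g] and the term in [L1] cancel between the two expansions; only the two remainders are
   left. *)
have -> : (b - a) * t - t ^+ 2 * L2 =
    t * ((b - (g + (c * L1 + t * L2))) - (a - (g + c * L1))) by ring.
rewrite normrM gtr0_norm// expr2 mulrCA ler_pM2l//.
apply: le_trans (ler_normB _ _) _.
by apply: le_trans (lerD r2 r1) _; rewrite -splitr.
Unshelve. all: by end_near. Qed.

(* Both iterated derivatives are the limit of the same symmetric second
   difference quotient. *)
Lemma derive_comm f y X Y :
  (\forall z \near y, differentiable f z) ->
  differentiable ('D_X f) y -> differentiable ('D_Y f) y ->
  'D_X ('D_Y f) y = 'D_Y ('D_X f) y.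
Proof.
move=> fd dX dY; apply/eqP; rewrite -subr_eq0 -normr_le0; apply/ler_addgt0Pr.
move=> e e0; rewrite add0r.
have e20 : 0 < e / 2 by rewrite divr_gt0.
have H1 := second_difference Y e20 fd dX.
have H2 := second_difference X e20 fd dY.
have [t [[h1 h2] t0]] := filter_ex (filterI (filterI H1 H2) (nbhs_right_gt 0)).
move: h1 h2 t0; rewrite [y + t *: Y + _]addrAC.
set A := f _; set a := f _; set b := f _; set c := f y.
set d1 := 'D_Y _ _; set d2 := 'D_X _ _ => h1 h2 t0.
have t20 : 0 < t ^+ 2 by rewrite exprn_gt0.
rewrite -(ler_pM2r t20) -{1}(gtr0_norm t20) -normrM.
have -> : (d2 - d1) * t ^+ 2 = (A - a - b + c - t ^+ 2 * d1)
   - (A - b - a + c - t ^+ 2 * d2) by ring.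
apply: le_trans (ler_normB _ _) _.
by apply: le_trans (lerD h1 h2) _; rewrite -mulrDl -splitr.
Qed.

End Schwarz.

Lemma near_eq_continuous (R : realType) (V W : normedModType R)
    (f g : V -> W) y :
  (\forall z \near y, f z = g z) -> {for y, continuous f} ->
  {for y, continuous g}.
Proof.
move=> fg fc; rewrite /prop_for /continuous_at -(nbhs_singleton fg).
by apply: cvg_trans fc; exact: near_eq_cvg.
Qed.

Lemma near_eq_differentiable (R : realType) (V W : normedModType R)
    (f g : V -> W) y :
  (\forall z \near y, f z = g z) -> differentiable f y -> differentiable g y.
Proof.
move=> fg fy; have [dc fE] := (diff_locallyP _ _).1 fy.
have gE : g \o shift y = cst (g y) + 'd f y +o_ 0 id.
  apply/eqaddoP => e e0; move/eqaddoP: fE => /(_ _ e0); apply: filter_app.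
  move: (fg); rewrite (near_shift 0).
  apply: filterS => h /=; rewrite subr0 => fgh.
  by rewrite !fctE /= fgh (nbhs_singleton fg).
by apply/diff_locallyP; rewrite (diff_unique dc gE).
Qed.

(** * Maps of class C^k on an open set *)

Section SmoothMaps.
Context {R : realType} {n : nat} (U : set 'rV[R]_n) (openU : open U).

Lemma open_near y : U y -> \forall z \near y, U z.
Proof. by move=> Uy; exact: open_nbhs_nbhs. Qed.

Lemma near_eq_on (T : Type) (f g : 'rV[R]_n -> T) y :
  (forall z, U z -> f z = g z) -> U y -> \forall z \near y, f z = g z.
Proof. by move=> fg /open_near; exact: filterS. Qed.

Section Normed.
Context {W : normedModType R}.
Implicit Types f g : 'rV[R]_n -> W.

Lemma eq_on_derive f g y v : (forall z, U z -> f z = g z) -> U y ->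
  'D_v f y = 'D_v g y.
Proof. by move=> fg Uy; apply: near_eq_derive; exact: near_eq_on. Qed.

Lemma eq_on_differentiable f g y : (forall z, U z -> f z = g z) -> U y ->
  differentiable f y -> differentiable g y.
Proof. by move=> fg Uy; apply: near_eq_differentiable; exact: near_eq_on. Qed.

(** Since [U] is open, equality on [U] passes to derivatives. This lets a formula for a derivative
    that is valid only on [U] be used in inductions on [k]. *)
Lemma class_C_eq k f g : (forall z, U z -> f z = g z) ->
  class_C k U f -> class_C k U g.
Proof.
elim: k f g => [|k IH] f g fg /=.
  by move=> fc x Ux; apply: near_eq_continuous (fc x Ux); exact: near_eq_on.
move=> [fd fD]; split=> [x Ux|v]; first exact: eq_on_differentiable (fd _ Ux).
by apply: IH (fD v) => z Uz; exact: eq_on_derive.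
Qed.

Lemma class_CW k f : class_C k.+1 U f -> class_C k U f.
Proof.
elim: k f => [|k IH] f [fd fD].
  by move=> x Ux; exact/differentiable_continuous/fd.
by split=> // v; apply: IH.
Qed.

Lemma class_C_cst k (w : W) : class_C k U (fun=> w).
Proof.
elim: k w => [|k IH] w; first by move=> x _; exact: cst_continuous.
split=> [x _|v]; first exact: differentiable_cst.
have -> : 'D_v (fun=> w) = (fun=> 0) :> ('rV[R]_n -> W).
  by apply/funext => z; exact: derive_cst.
exact: IH.
Qed.

Lemma class_CD k f g : class_C k U f -> class_C k U g ->
  class_C k U (fun z => f z + g z).
Proof.
elim: k f g => [|k IH] f g; first by move=> fc gc x Ux; apply: continuousD;
  auto.
move=> [fd fD] [gd gD]; split=> [x Ux|v]; first by apply: differentiableD; auto.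
apply: class_C_eq (IH _ _ (fD v) (gD v)) => z Uz.
by rewrite -deriveD//; apply: diff_derivable; auto.
Qed.

Lemma class_C_sum k (I : Type) (r : seq I) (f : I -> 'rV[R]_n -> W) :
  (forall i, class_C k U (f i)) -> class_C k U (fun z => \sum_(i <- r) f i z).
Proof.
move=> fC; elim: r => [|i r IH].
  by under [X in class_C _ _ X]funext do rewrite big_nil; exact: class_C_cst.
by under [X in class_C _ _ X]funext do rewrite big_cons; exact: class_CD.
Qed.

End Normed.

Lemma continuous_sumr (W : normedModType R) (I : Type) (r : seq I)
    (f : I -> 'rV[R]_n -> W) x :
  (forall i, {for x, continuous (f i)}) ->
  {for x, continuous (fun z => \sum_(i <- r) f i z)}.
Proof.
move=> fc; elim: r => [|i r IH].
  have -> : (fun z => \sum_(i <- [::]) f i z) = (fun=> 0).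
    by apply/funext => z; rewrite big_nil.
  exact: cst_continuous.
have -> : (fun z => \sum_(i <- i :: r) f i z) =
          f i + (fun z => \sum_(i <- r) f i z).
  by apply/funext => z; rewrite big_cons.
exact: continuousD.
Qed.

Lemma class_C_linmx k p q (W : normedModType R) (L : {linear 'M[R]_(p, q) -> W})
    (M : 'rV[R]_n -> 'M[R]_(p, q)) :
  class_C k U M -> class_C k U (fun z => L (M z)).
Proof.
elim: k M => [|k IH] M.
  move=> Mc x Ux; apply: (continuous_comp (Mc x Ux)).
  exact/differentiable_continuous/differentiable_linmx.
move=> [Md MD]; split=> [x Ux|v]; first exact/differentiable_linmx_comp/Md.
apply: class_C_eq (IH _ (MD v)) => z Uz.
by rewrite derive_linmx//; exact: Md.
Qed.

Lemma continuous_mulmx p q r (M : 'rV[R]_n -> 'M[R]_(p, q))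
    (N : 'rV[R]_n -> 'M[R]_(q, r)) x :
  {for x, continuous M} -> {for x, continuous N} ->
  {for x, continuous (fun z => M z *m N z)}.
Proof.
move=> Mc Nc.
have mxc a b (Q : 'rV[R]_n -> 'M[R]_(a, b)) : {for x, continuous Q} ->
    forall i j, {for x, continuous (fun z => Q z i j)}.
  move=> Qc i j; 
  exact: (continuous_comp Qc
    (differentiable_continuous (differentiable_coord (Q x) i j))).
have -> : (fun z => M z *m N z) =
    (fun z => \sum_i \sum_j ((\sum_k M z i k * N z k j) *: delta_mx i j)).
  apply/funext => z; rewrite [LHS]matrix_sum_delta.
  by apply: eq_bigr => i _; apply: eq_bigr => j _; rewrite mxE.
apply: continuous_sumr => i; apply: continuous_sumr => j.
apply: continuousZr_tmp; apply: continuous_sumr => k.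
by apply: continuousM; exact: mxc.
Qed.

Lemma class_C_mulmx k p q r (M : 'rV[R]_n -> 'M[R]_(p, q))
    (N : 'rV[R]_n -> 'M[R]_(q, r)) :
  class_C k U M -> class_C k U N -> class_C k U (fun z => M z *m N z).
Proof.
elim: k M N => [|k IH] M N.
  by move=> Mc Nc x Ux; apply: continuous_mulmx; auto.
move=> MC NC; have [Md MD] := MC; have [Nd ND] := NC.
split=> [x Ux|v]; first by apply: differentiable_mulmx; auto.
apply: class_C_eq (class_CD (IH _ _ (MD v) (class_CW NC))
                            (IH _ _ (class_CW MC) (ND v))) => z Uz.
by rewrite derive_mulmx//; auto.
Qed.

(** The reciprocal is kept as a 1 by 1 matrix, so that its derivative [- h^-1 h' h^-1] is again a
    matrix product and the induction can use [class_C_mulmx]. *)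
Lemma class_C_inv k (h : 'rV[R]_n -> 'M[R]_1) :
  (forall z, U z -> h z 0 0 != 0) -> class_C k U h ->
  class_C k U (fun z => (h z 0 0)^-1%:M : 'M[R]_1).
Proof.
move=> h0; elim: k h h0 => [|k IH] h h0.
  move=> hc x Ux.
  have -> : (fun z => (h z 0 0)^-1%:M : 'M[R]_1) =
            (fun z => (h z 0 0)^-1 *: (1%:M : 'M[R]_1)).
    by apply/funext => z; rewrite scalemx1.
  apply: continuousZr_tmp; apply: continuousV; first exact: h0.
  exact: (continuous_comp (hc _ Ux)
    (differentiable_continuous (differentiable_coord (h x) 0 0))).
move=> hC; have [hd hD] := hC.
have d1 x : U x -> differentiable (fun z => (h z 0 0)^-1 : R) x.
  move=> Ux; apply: differentiableV; last exact: h0.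
  by have /differentiable_mxP := hd _ Ux.
have d2 x : U x -> differentiable (fun z => (h z 0 0)^-1%:M : 'M[R]_1) x.
  move=> Ux; apply/differentiable_mxP => i j; rewrite !ord1.
  have -> : (fun z => ((h z 0 0)^-1%:M : 'M[R]_1) 0 0) = (fun z => (h z 0
    0)^-1).
    by apply/funext => z; rewrite mxE mulr1n.
  exact: d1.
split=> // v.
have hi := IH _ h0 (class_CW hC).
apply: class_C_eq (class_C_linmx (mulmx (- 1%:M))
  (class_C_mulmx hi (class_C_mulmx (hD v) hi))) => z Uz.
apply/matrixP => i j; rewrite !ord1 derive_mxE; last exact: d2.
have -> : (fun z => ((h z 0 0)^-1%:M : 'M[R]_1) 0 0) =
    (fun z => (h z 0 0)^-1).
  by apply/funext => t; rewrite mxE mulr1n.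
rewrite deriveV ?h0//; last first.
  by apply: diff_derivable; have /differentiable_mxP := hd _ Uz.
rewrite !mxE !big_ord1 !mxE !big_ord1 !mxE !mulr1n -derive_mxE; last exact: hd.
rewrite big_ord1 !mxE mulr1n; set d : R := 'D_v h z 0 0.
by rewrite /GRing.scale/=; field; exact: h0.
Qed.

(** Reduction to [derive_comm] entry by entry; derivatives of entries agree with entries of
    derivatives only on [U], hence the passage through [eq_on_derive]. *)
Lemma derive_comm_mx p q (f : 'rV[R]_n -> 'M[R]_(p, q)) y X Y :
  class_C 2 U f -> U y -> 'D_X ('D_Y f) y = 'D_Y ('D_X f) y.
Proof.
move=> [fd fD] Uy; apply/matrixP => i j.
have Dd v : differentiable ('D_v f) y by have [dv _] := fD v; exact: dv.
have E v z : U z -> 'D_v f z i j = 'D_v (fun t => f t i j) z.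
  by move=> Uz; apply: derive_mxE; exact: fd.
have E2 u v : 'D_u ('D_v f) y i j = 'D_u ('D_v (fun t => f t i j)) y.
  by rewrite -(eq_on_derive u (E v) Uy); apply: derive_mxE; exact: Dd.
apply: (etrans (E2 X Y)); apply: (etrans _ (esym (E2 Y X))).
have C v : differentiable ('D_v (fun t => f t i j)) y.
  apply: (eq_on_differentiable (E v) Uy); 
  by have /differentiable_mxP := Dd v.
apply: derive_comm => //; near=> z.
have Uz : U z by near: z; exact: open_near.
exact: ((differentiable_mxP f z).1 (fd z Uz) i j).
Unshelve. all: by end_near. Qed.

End SmoothMaps.

(** * Scalars and projections onto lines *)

Section EuclideanMatrices.
Context {R : realType}.

Lemma mxdotE m n (u v : 'M[R]_(m, n)) : mxdot u v = \sum_i \sum_j u i j * v i j.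
Proof.
rewrite /mxdot /mxtrace; apply: eq_bigr => i _; rewrite mxE.
by apply: eq_bigr => j _; rewrite mxE.
Qed.

Lemma mxdotC m n (u v : 'M[R]_(m, n)) : mxdot u v = mxdot v u.
Proof. by rewrite /mxdot -mxtrace_tr trmx_mul trmxK. Qed.

Lemma mxdotDl m n (u u' v : 'M[R]_(m, n)) : mxdot (u + u') v = mxdot u v +
  mxdot u' v.
Proof. by rewrite /mxdot mulmxDl linearD. Qed.

Lemma mxdotZl m n k (u v : 'M[R]_(m, n)) : mxdot (k *: u) v = k * mxdot u v.
Proof. by rewrite /mxdot -scalemxAl linearZ. Qed.

Lemma mxdotNl m n (u v : 'M[R]_(m, n)) : mxdot (- u) v = - mxdot u v.
Proof. by rewrite -scaleN1r mxdotZl mulN1r. Qed.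

Lemma mxdotBl m n (u u' v : 'M[R]_(m, n)) : mxdot (u - u') v = mxdot u v -
  mxdot u' v.
Proof. by rewrite mxdotDl mxdotNl. Qed.

Lemma mxdotDr m n (u u' v : 'M[R]_(m, n)) : mxdot v (u + u') = mxdot v u +
  mxdot v u'.
Proof. by rewrite mxdotC mxdotDl !(mxdotC v). Qed.

Lemma mxdotZr m n k (u v : 'M[R]_(m, n)) : mxdot v (k *: u) = k * mxdot v u.
Proof. by rewrite mxdotC mxdotZl mxdotC. Qed.

Lemma mxdotNr m n (u v : 'M[R]_(m, n)) : mxdot v (- u) = - mxdot v u.
Proof. by rewrite mxdotC mxdotNl mxdotC. Qed.

Lemma mxdotBr m n (u u' v : 'M[R]_(m, n)) : mxdot v (u - u') = mxdot v u -
  mxdot v u'.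
Proof. by rewrite mxdotDr mxdotNr. Qed.

Lemma mxdot0l m n (v : 'M[R]_(m, n)) : mxdot 0 v = 0.
Proof. by rewrite /mxdot mul0mx linear0. Qed.

Lemma mxdot_suml m n (I : Type) (r : seq I) (F : I -> 'M[R]_(m, n)) v :
  mxdot (\sum_(i <- r) F i) v = \sum_(i <- r) mxdot (F i) v.
Proof.
by elim/big_ind2: _ => [|_ x _ y <- <-|//]; rewrite ?mxdot0l ?mxdotDl.
Qed.

Lemma mxdot_ge0 m n (v : 'M[R]_(m, n)) : 0 <= mxdot v v.
Proof.
by rewrite mxdotE !sumr_ge0// => i _; rewrite sumr_ge0// => j _; rewrite -expr2
  sqr_ge0.
Qed.

Lemma mxdot_eq0 m n (v : 'M[R]_(m, n)) : (mxdot v v == 0) = (v == 0).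
Proof.
apply/idP/eqP => [|->]; last by rewrite mxdot0l.
have h i j : 0 <= v i j * v i j by rewrite -expr2 sqr_ge0.
rewrite mxdotE psumr_eq0 => [/allP v0|i _]; last by rewrite sumr_ge0.
apply/matrixP => i j; rewrite mxE; apply/eqP.
have := v0 i (mem_index_enum _); rewrite psumr_eq0//= => /allP /(_ j).
by rewrite mem_index_enum mulf_eq0 orbb; apply.
Qed.

Lemma mxdot_gt0 m n (v : 'M[R]_(m, n)) : (0 < mxdot v v) = (v != 0).
Proof. by rewrite lt_neqAle mxdot_ge0 andbT eq_sym mxdot_eq0. Qed.

Lemma mxdot_mulmx m n p (u : 'M[R]_(m, n)) (A : 'M[R]_(n, p)) v :
  mxdot (u *m A) v = mxdot u (v *m A^T).
Proof. by rewrite /mxdot trmx_mul trmxK mulmxA. Qed.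

Lemma mxdot_mxvec m n (u v : 'M[R]_(m, n)) : mxdot (mxvec u) (mxvec v) = mxdot
  u v.
Proof.
rewrite !mxdotE big_ord1 pair_bigA /= (reindex _ (curry_mxvec_bij _ _)) /=.
by apply: eq_bigr => -[i j] _; rewrite !mxvecE.
Qed.

Lemma mxdot_row n (u v : 'rV[R]_n) : u *m v^T = (mxdot u v)%:M.
Proof. by rewrite /mxdot [LHS]mx11_scalar /mxtrace big_ord1. Qed.

(** The difference of two candidates lies in [L] and is orthogonal to [L], hence to itself. *)
Lemma orthproj_eq m n (L : set 'M[R]_(m, n)) w p : L p ->
  (forall u, L u -> mxdot (w - p) u = 0) ->
  (forall u v, L u -> L v -> L (u - v)) -> orthproj L w = p.
Proof.
move=> Lp pP Lsub; apply: xget_unique; first by split.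
move=> q [Lq qP]; apply/eqP; rewrite -subr_eq0 -mxdot_eq0.
have Lqp := Lsub _ _ Lq Lp.
rewrite -[X in mxdot X](_ : (w - p) - (w - q) = _); last first.
  by rewrite opprB addrC addrA subrK.
by rewrite mxdotBl pP// qP// subrr.
Qed.

End EuclideanMatrices.

(** * Scalars of C and H as real matrices *)

Section ScalarMatrices.
Context {R : realType}.

Definition crho (a : 'rV[R]_2) : 'M[R]_2 :=
  let a0 := a 0 (inord 0) in let a1 := a 0 (inord 1) in
  \matrix_(i, j) nth 0 (nth [::] [:: [:: a0; a1]; [:: - a1; a0]] i) j.

Definition hrho (a : 'rV[R]_4) : 'M[R]_4 :=
  let a0 := a 0 (inord 0) in let a1 := a 0 (inord 1) in
  let a2 := a 0 (inord 2) in let a3 := a 0 (inord 3) in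
  \matrix_(i, j) nth 0 (nth [::] [:: [:: a0; a1; a2; a3];
                                     [:: - a1; a0; - a3; a2];
                                     [:: - a2; a3; a0; - a1];
                                     [:: - a3; - a2; a1; a0]] i) j.

(** The matrix of right multiplication by a scalar on rows of coordinates. It turns identities
    between scalars into identities between real matrices, treated alike for C and H. *)
Definition rho (K : scalars) : 'rV[R]_(dimK K) -> 'M[R]_(dimK K) :=
  match K with Complexes => crho | Quaternions => hrho end.

Lemma ord2P (P : 'I_2 -> Prop) : P (inord 0) -> P (inord 1) -> forall i, P i.
Proof.
move=> P0 P1 [[|[|//]] i2].
  by rewrite (_ : Ordinal i2 = inord 0)//; apply: val_inj; rewrite /= inordK.
by rewrite (_ : Ordinal i2 = inord 1)//; apply: val_inj; rewrite /= inordK.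
Qed.

Lemma ord4P (P : 'I_4 -> Prop) : P (inord 0) -> P (inord 1) -> P (inord 2) ->
  P (inord 3) -> forall i, P i.
Proof.
move=> P0 P1 P2 P3 [[|[|[|[|//]]]] i4].
- by rewrite (_ : Ordinal i4 = inord 0)//; apply: val_inj; rewrite /= inordK.
- by rewrite (_ : Ordinal i4 = inord 1)//; apply: val_inj; rewrite /= inordK.
- by rewrite (_ : Ordinal i4 = inord 2)//; apply: val_inj; rewrite /= inordK.
- by rewrite (_ : Ordinal i4 = inord 3)//; apply: val_inj; rewrite /= inordK.
Qed.

Lemma sum_ord2 (F : 'I_2 -> R) : \sum_i F i = F (inord 0) + F (inord 1).
Proof.
rewrite !big_ord_recl big_ord0 addr0.
by congr (F _ + F _); apply: val_inj; rewrite /= inordK.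
Qed.

Lemma sum_ord4 (F : 'I_4 -> R) :
  \sum_i F i = F (inord 0) + F (inord 1) + F (inord 2) + F (inord 3).
Proof.
rewrite !big_ord_recl big_ord0 addr0 !addrA.
by congr (F _ + F _ + F _ + F _); apply: val_inj; rewrite /= inordK.
Qed.

Lemma kmulE K (x a : 'rV[R]_(dimK K)) : kmul x a = x *m rho a.
Proof.
apply/rowP; case: K x a => x a.
  by apply: ord2P; rewrite !mxE sum_ord2 !mxE !inordK//=; ring.
by apply: ord4P; rewrite !mxE sum_ord4 !mxE !inordK//=; ring.
Qed.

Lemma rho_linear K (k : R) (a b : 'rV[R]_(dimK K)) :
  rho (k *: a + b) = k *: rho a + rho b.
Proof.
apply/matrixP; case: K a b => a b.
  by apply: ord2P; apply: ord2P; rewrite !mxE !inordK//=; ring.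
by apply: ord4P; apply: ord4P; rewrite !mxE !inordK//=; ring.
Qed.

(** Here [a *m rho b] is the scalar product of [a] and [b], so this is associativity of the
    scalars. *)
Lemma rhoM K (a b : 'rV[R]_(dimK K)) : rho a *m rho b = rho (a *m rho b).
Proof.
apply/matrixP; case: K a b => a b.
  by apply: ord2P; apply: ord2P; rewrite !mxE !sum_ord2 !mxE !inordK//=; ring.
by apply: ord4P; apply: ord4P; rewrite !mxE !sum_ord4 !mxE !inordK//=; ring.
Qed.

(** Transposition corresponds to conjugation of scalars, and a scalar plus its conjugate is twice
    its real part. *)
Lemma rho_tr K (a : 'rV[R]_(dimK K)) : rho a + (rho a)^T = (2 * a 0 ord0)%:M.
Proof.
have i0 n : ord0 = inord 0 :> 'I_n.+1 by apply: val_inj; rewrite /= inordK.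
apply/matrixP; case: K a => a; rewrite i0.
  by apply: ord2P; apply: ord2P; rewrite !mxE -val_eqE /= !inordK//=; ring.
by apply: ord4P; apply: ord4P; rewrite !mxE -val_eqE /= !inordK//=; ring.
Qed.

Lemma rho1 K : rho (kone K : 'rV[R]_(dimK K)) = 1%:M.
Proof.
have i0 n : ord0 = inord 0 :> 'I_n.+1 by apply: val_inj; rewrite /= inordK.
apply/matrixP; rewrite /kone i0; case: K.
  by apply: ord2P; apply: ord2P; rewrite !mxE -!val_eqE /= !inordK//= ?oppr0.
by apply: ord4P; apply: ord4P; rewrite !mxE -!val_eqE /= !inordK//= ?oppr0.
Qed.

Lemma rho_norm K (a : 'rV[R]_(dimK K)) : rho a *m (rho a)^T = (mxdot a a)%:M.
Proof.
apply/matrixP; rewrite mxdotE big_ord1; case: K a => a.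
  by apply: ord2P; apply: ord2P; rewrite !mxE !sum_ord2 !mxE -val_eqE /=
    !inordK//=; ring.
by apply: ord4P; apply: ord4P; rewrite !mxE !sum_ord4 !mxE -val_eqE /=
  !inordK//=; ring.
Qed.

End ScalarMatrices.

(** * The line spanned by a vector of K^N *)

Section Lines.
Context {R : realType} {K : scalars} {N : nat}.
Local Notation d := (dimK K).
Implicit Types (u v w : 'M[R]_(N, d)) (a b c : 'rV[R]_d).

Lemma rhoD a b : rho (a + b) = rho a + rho b.
Proof. by rewrite -[a]scale1r rho_linear !scale1r. Qed.

Lemma rho0 : rho (0 : 'rV[R]_d) = 0.
Proof.
by apply: (addrI (rho (0 : 'rV[R]_d))); rewrite -rhoD !addr0.
Qed.

Lemma rhoZ k a : rho (k *: a) = k *: rho a.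
Proof. by rewrite -[k *: a]addr0 rho_linear rho0 addr0. Qed.

Lemma rhoN a : rho (- a) = - rho a.
Proof. by rewrite -scaleN1r rhoZ scaleN1r. Qed.

Lemma rho_sum (I : Type) (r : seq I) (F : I -> 'rV[R]_d) :
  rho (\sum_(i <- r) F i) = \sum_(i <- r) rho (F i).
Proof.
by elim/big_ind2: _ => [|_ x _ y <- <-|//]; rewrite ?rho0 ?rhoD.
Qed.

Lemma kscaleE v a : kscale v a = v *m rho a.
Proof. by apply/row_matrixP => i; rewrite rowK kmulE row_mul. Qed.

Definition kconj a : 'rV[R]_d := (2 * a 0 ord0) *: kone K - a.

Lemma rho_conj a : rho (kconj a) = (rho a)^T.
Proof. by rewrite rhoD rhoZ rhoN rho1 scalemx1 -rho_tr addrC addKr. Qed.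

(** Polarization of [rho_norm]. *)
Lemma rho_polar a b :
  rho a *m (rho b)^T + rho b *m (rho a)^T = (2 * mxdot a b)%:M.
Proof.
have := rho_norm (a + b); rewrite rhoD linearD /= mulmxDl !mulmxDr !rho_norm.
rewrite mxdotDl !mxdotDr (mxdotC b a).
set A := _ *m _; set B := _ *m _ => /matrixP h.
by apply/matrixP => i j; have := h i j; rewrite !mxE; case: eqP => _; lra.
Qed.

(** After doubling, moving the scalars to one side produces the sum in [rho_polar], which is a real
    number. In particular the vectors [v *m rho e] for [e] in the standard basis of K are orthogonal
    and as long as [v]. *)
Lemma mxdot_rho v a b :
  mxdot (v *m rho a) (v *m rho b) = mxdot a b * mxdot v v.
Proof.
apply: (@mulfI _ 2); first by rewrite pnatr_eq0.
rewrite mulrA mulr_natl mulr2n {1}mxdotC !mxdot_mulmx -!mulmxA -mxdotDr.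
by rewrite -mulmxDr rho_polar mul_mx_scalar mxdotZr.
Qed.

Lemma kline_rho v w : kline v w <-> exists a, w = v *m rho a.
Proof.
split=> [[a _ <-]|[a ->]]; first by exists a; rewrite kscaleE.
by exists a => //; rewrite kscaleE.
Qed.

Lemma klineB v u w : kline v u -> kline v w -> kline v (u - w).
Proof.
move=> /kline_rho[a ->] /kline_rho[b ->]; apply/kline_rho; exists (a - b).
by rewrite rhoD rhoN mulmxDr mulmxN.
Qed.

Lemma kline_mulmx_rho v w a : kline v w -> kline v (w *m rho a).
Proof.
by move=> /kline_rho[b ->]; apply/kline_rho; exists (b *m rho a); rewrite
  -mulmxA rhoM.
Qed.

Lemma kline_id v : kline v v.
Proof. by apply/kline_rho; exists (kone K); rewrite rho1 mulmx1. Qed.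

Lemma kline_sym v w : w != 0 -> kline v w -> kline w = kline v.
Proof.
move=> w0 vw; apply/seteqP; split=> u; last first.
  have [a wE] := (kline_rho _ _).1 vw.
  have a0 : mxdot a a != 0.
    by rewrite mxdot_eq0; apply: contraNneq w0 => a0; rewrite wE a0 rho0 mulmx0.
  (* The inverse of a nonzero scalar is its conjugate divided by its squared norm. *)
  have vE : v = w *m rho ((mxdot a a)^-1 *: kconj a).
    by rewrite wE rhoZ rho_conj -mulmxA -scalemxAr rho_norm scale_scalar_mx
      mulVf// mulmx1.
  move=> /kline_rho[b ->]; rewrite {1}vE.
  by apply: kline_mulmx_rho; apply/kline_rho; eexists.
by move=> /kline_rho[b ->]; exact: kline_mulmx_rho.
Qed.

End Lines.

(** * Real operators on K^N *)

Section Operators.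
Context {R : realType} {N d : nat}.
Implicit Types (A B : 'M[R]_(N * d)) (u v w : 'M[R]_(N, d)).

(** Operators act on the right of the flattened vector, so a product [A *m B] means first [A], then
    [B]. *)
Definition opv A w : 'M[R]_(N, d) := vec_mx (mxvec w *m A).

Lemma opvDr A u v : opv A (u + v) = opv A u + opv A v.
Proof. by rewrite /opv linearD mulmxDl linearD. Qed.

Lemma opv0r A : opv A 0 = 0.
Proof. by rewrite /opv linear0 mul0mx linear0. Qed.

Lemma opvZr k A u : opv A (k *: u) = k *: opv A u.
Proof. by rewrite /opv linearZ -scalemxAl linearZ. Qed.

Lemma opvNr A u : opv A (- u) = - opv A u.
Proof. by rewrite -scaleN1r opvZr scaleN1r. Qed.

Lemma opvBr A u v : opv A (u - v) = opv A u - opv A v.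
Proof. by rewrite opvDr opvNr. Qed.

Lemma opvDl A B u : opv (A + B) u = opv A u + opv B u.
Proof. by rewrite /opv mulmxDr linearD. Qed.

Lemma opvZl k A u : opv (k *: A) u = k *: opv A u.
Proof. by rewrite /opv -scalemxAr linearZ. Qed.

Lemma opvNl A u : opv (- A) u = - opv A u.
Proof. by rewrite -scaleN1r opvZl scaleN1r. Qed.

Lemma opvBl A B u : opv (A - B) u = opv A u - opv B u.
Proof. by rewrite opvDl opvNl. Qed.

Lemma opvM A B u : opv (A *m B) u = opv B (opv A u).
Proof. by rewrite /opv vec_mxK mulmxA. Qed.

Lemma mxdot_opv A u v : mxdot (opv A u) v = mxdot u (opv A^T v).
Proof.
by rewrite -[LHS]mxdot_mxvec -[RHS]mxdot_mxvec /opv !vec_mxK mxdot_mulmx.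
Qed.

Lemma opv_inj A B : (forall u, opv A u = opv B u) -> A = B.
Proof.
move=> AB; apply/row_matrixP => i; rewrite !rowE.
by rewrite -[delta_mx 0 i]vec_mxK; apply: (can_inj vec_mxK); exact: AB.
Qed.

End Operators.

(** * The orthogonal projection onto a line, and K-linear symmetric operators *)

Section LineProjection.
Context {R : realType} {K : scalars} {N : nat}.
Local Notation d := (dimK K).
Implicit Types (u v w : 'M[R]_(N, d)) (a b c : 'rV[R]_d) (A B C : 'M[R]_(N *
  d)).

(* The projection onto the line of [v], from its orthogonal real basis
   [v e_l], where [e_l] runs over the standard basis of K. *)
Definition projmx v : 'M[R]_(N * d) :=
  \sum_l (mxvec (v *m rho (delta_mx 0 l)))^T *m ((mxdot v v)^-1)%:M
         *m mxvec (v *m rho (delta_mx 0 l)).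

Lemma opv_projmx v w : opv (projmx v) w =
  \sum_l ((mxdot v v)^-1 * mxdot w (v *m rho (delta_mx 0 l)))
         *: (v *m rho (delta_mx 0 l)).
Proof.
rewrite /opv mulmx_sumr linear_sum; apply: eq_bigr => l _.
rewrite mul_mx_scalar -scalemxAl -scalemxAr mulmxA mxdot_row mxdot_mxvec.
by rewrite mul_scalar_mx scalerA linearZ /= mxvecK.
Qed.

Lemma projmx_line v w : kline v (opv (projmx v) w).
Proof.
apply/kline_rho; exists (\sum_l ((mxdot v v)^-1 *
  mxdot w (v *m rho (delta_mx 0 l))) *: (delta_mx 0 l)).
rewrite opv_projmx rho_sum mulmx_sumr; apply: eq_bigr => l _.
by rewrite rhoZ scalemxAr.
Qed.

Lemma mxdot_delta (l m : 'I_d) :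
  mxdot (delta_mx 0 l : 'rV[R]_d) (delta_mx 0 m) = (l == m)%:R.
Proof.
rewrite mxdotE big_ord1 (bigD1 l)//= big1 ?addr0 ?mxE ?eqxx ?mul1r => [//|i il].
by rewrite !mxE (negbTE il) mul0r.
Qed.

(** By linearity it suffices to test on the basis [v *m rho (delta_mx 0 m)] of the line, which is
    orthogonal by [mxdot_rho]. *)
Lemma projmx_orth v u w : v != 0 -> kline v u ->
  mxdot (w - opv (projmx v) w) u = 0.
Proof.
rewrite -mxdot_eq0 => v0 /kline_rho[a ->].
have -> : a = \sum_l a 0 l *: delta_mx 0 l by exact: row_sum_delta.
rewrite rho_sum mulmx_sumr mxdotC mxdot_suml big1// => m _.
rewrite rhoZ -scalemxAr mxdotZl mxdotBr (mxdotC _ (opv _ _)) opv_projmx.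
rewrite mxdot_suml (bigD1 m)//= big1 => [|l lm].
  rewrite mxdotZl mxdot_rho mxdot_delta eqxx mul1r mulrAC mulVf// mul1r addr0.
  by rewrite mxdotC subrr mulr0.
by rewrite mxdotZl mxdot_rho mxdot_delta (negbTE lm) mul0r mulr0.
Qed.

Lemma orthproj_line v w : v != 0 -> orthproj (kline v) w = opv (projmx v) w.
Proof.
move=> v0; apply: orthproj_eq; first exact: projmx_line.
  by move=> u vu; exact: projmx_orth.
by move=> ? ?; exact: klineB.
Qed.

Lemma orthproj_id v w : kline v w -> orthproj (kline v) w = w.
Proof.
move=> vw; apply: orthproj_eq => // [u _|]; first by rewrite subrr mxdot0l.
by move=> ? ?; exact: klineB.
Qed.

Lemma projmx_id v w : v != 0 -> kline v w -> opv (projmx v) w = w.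
Proof. by move=> v0 vw; rewrite -orthproj_line// orthproj_id. Qed.

Lemma projmx_tr v : (projmx v)^T = projmx v.
Proof.
rewrite /projmx linear_sum; apply: eq_bigr => l _ /=.
by rewrite !trmx_mul trmxK tr_scalar_mx mulmxA.
Qed.

Lemma projmx_idem v : v != 0 -> projmx v *m projmx v = projmx v.
Proof.
move=> v0; apply: opv_inj => u; rewrite opvM projmx_id//; exact: projmx_line.
Qed.

Definition klinear A := forall w a, opv A (w *m rho a) = opv A w *m rho a.

(** The line is stable under right multiplication by scalars, and so is its orthogonal complement,
    because the adjoint of a scalar is its conjugate. *)
Lemma projmx_klinear v : v != 0 -> klinear (projmx v).
Proof.
move=> v0 w a; rewrite -orthproj_line//; apply: orthproj_eq.
- exact/kline_mulmx_rho/projmx_line.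
- move=> u vu; rewrite -mulmxBl mxdot_mulmx projmx_orth// -rho_conj.
  exact: kline_mulmx_rho.
- by move=> ? ?; exact: klineB.
Qed.

(* Only the block of [A] from the line to its orthogonal complement enters,
   twice by symmetry. *)
Lemma mxtrace_offdiag v A B : v != 0 -> klinear A -> klinear B ->
  A^T = A -> B^T = B -> A = A *m projmx v + projmx v *m A ->
  \tr (A *m B) = 2 * d%:R * (mxdot v v)^-1 * mxdot (opv A v) (opv B v).
Proof.
move=> v0 Al Bl As Bs AP; rewrite {1}AP mulmxDl mxtraceD.
have -> : \tr (A *m projmx v *m B) = \tr (projmx v *m A *m B).
  by rewrite -mxtrace_tr !trmx_mul projmx_tr As Bs mxtrace_mulC.
rewrite -mulr2n -mulrA -mulrA mulr_natl; congr (_ *+ 2).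
(* All [d] basis vectors of the line contribute equally: [A] and [B] commute with the scalar
   [delta_mx 0 l], which has norm 1. *)
have term l : \tr ((mxvec (v *m rho (delta_mx 0 l)))^T
      *m ((mxdot v v)^-1)%:M *m mxvec (v *m rho (delta_mx 0 l)) *m A *m B) =
    (mxdot v v)^-1 * mxdot (opv A v) (opv B v).
  rewrite mul_mx_scalar -!scalemxAl linearZ /= -!mulmxA mxtrace_mulC.
  set r := mxvec _.
  have -> : r *m (A *m B) *m r^T = r *m A *m (r *m B)^T.
    by rewrite trmx_mul Bs !mulmxA.
  rewrite -/(mxdot _ _) /r.
  rewrite -[mxvec _ *m A]vec_mxK -[mxvec _ *m B]vec_mxK mxdot_mxvec.
  rewrite -/(opv A _) -/(opv B _) Al Bl mxdot_mulmx -mulmxA rho_norm.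
  by rewrite mxdot_delta eqxx mulmx1.
rewrite /projmx !mulmx_suml linear_sum /= (eq_bigr _ (fun l _ => term l)).
by rewrite sumr_const card_ord mulr_natl.
Qed.

(** Symmetry moves the outer operator to the other argument and K-linearity pulls the scalars out.
    Both terms then pair [opv B v] with [opv A v], through the scalars [a b^*] and [b a^*]
    respectively. *)
Lemma mxdot_commutator v A B a b c t : klinear A -> klinear B ->
  A^T = A -> B^T = B -> rho a *m (rho b)^T - rho b *m (rho a)^T = t *: rho c ->
  mxdot (opv A (opv B (v *m rho a))) (v *m rho b)
  - mxdot (opv B (opv A (v *m rho a))) (v *m rho b)
  = t * mxdot (opv B v *m rho c) (opv A v).
Proof.
move=> Al Bl As Bs abc.
rewrite [X in X - _]mxdot_opv [X in _ - X]mxdot_opv As Bs !Al !Bl.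
rewrite (mxdotC (opv A v *m _)) -mxdotZl scalemxAr -abc mulmxBr mxdotBl !mulmxA.
by rewrite [in RHS]mxdot_mulmx [X in _ = _ - X]mxdot_mulmx !trmxK.
Qed.

End LineProjection.

(** * Geometry induced by a map to a Euclidean space *)

Section Gradient.
Context {R : realType}.

Lemma derive_linear (V W : normedModType R) (f : V -> W) y k (X Y : V) :
  differentiable f y -> 'D_(k *: X + Y) f y = k *: 'D_X f y + 'D_Y f y.
Proof. by move=> fd; rewrite !deriveE// linearP. Qed.

Lemma derive_mxdot (V : normedModType R) m n (M N : V -> 'M[R]_(m, n)) y v :
  differentiable M y -> differentiable N y ->
  'D_v (fun z => mxdot (M z) (N z) : R^o) y =
  mxdot ('D_v M y) (N y) + mxdot (M y) ('D_v N y).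
Proof.
move=> Md Nd.
have Ntd : differentiable (fun z => (N z)^T) y.
  exact: (differentiable_linmx_comp trmx Nd).
rewrite /mxdot.
rewrite (derive_linmx (mxtrace : 'M[R]_m -> R^o) v (differentiable_mulmx Md
  Ntd)).
by rewrite derive_mulmx// (derive_linmx trmx v Nd) linearD.
Qed.

Lemma derive_scalemx (V : normedModType R) m n (c : V -> R) (M : V -> 'M[R]_(m,
  n)) y v :
  differentiable c y -> differentiable M y ->
  differentiable (fun z => c z *: M z) y /\
  'D_v (fun z => c z *: M z) y = 'D_v c y *: M y + c y *: 'D_v M y.
Proof.
move=> cd Md; have Md' := (differentiable_mxP _ _).1 Md.
have E i j : (fun z => (c z *: M z) i j) = (c * (fun z => M z i j)).
  by apply/funext => z; rewrite mxE.
have d : differentiable (fun z => c z *: M z) y.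
  by apply/differentiable_mxP => i j; rewrite E; exact: differentiableM.
split=> //; apply/matrixP => i j; rewrite derive_mxE// E.
rewrite deriveM; [|exact: diff_derivable|exact/diff_derivable/Md'].
by rewrite !mxE -(derive_mxE _ _ _ Md) addrC; congr (_ + _); exact: mulrC.
Qed.

(** Riesz representation for the inner product pulled back by an injective linear map: a vector in
    the kernel of the Gram matrix has an image of length 0. It provides the existence needed for the
    [xget] in [christoffel], [tanproj] and [shape_operator]. *)
Lemma gram_riesz n p q (A : 'rV[R]_n -> 'M[R]_(p, q)) (l : 'rV[R]_n -> R) :
  (forall k X Y, A (k *: X + Y) = k *: A X + A Y) ->
  (forall X, A X = 0 -> X = 0) ->
  (forall k X Y, l (k *: X + Y) = k * l X + l Y) ->
  exists T, forall Z, mxdot (A T) (A Z) = l Z.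
Proof.
move=> Alin Ainj llin.
pose AL : {linear 'rV[R]_n -> 'M[R]_(p, q)} :=
  HB.pack A (GRing.isLinear.Build _ _ _ _ A Alin).
pose lL : {linear 'rV[R]_n -> R^o} :=
  HB.pack (l : 'rV[R]_n -> R^o) (GRing.isLinear.Build _ _ _ _ (l : 'rV[R]_n ->
    R^o) llin).
pose e i : 'rV[R]_n := delta_mx 0 i.
have AE T : A T = \sum_i T 0 i *: A (e i).
  rewrite -[LHS]/(AL T) {1}(row_sum_delta T) linear_sum.
  by apply: eq_bigr => i _; rewrite linearZ.
have lE T : l T = \sum_i T 0 i * l (e i).
  rewrite -[LHS]/(lL T) {1}(row_sum_delta T) linear_sum.
  by apply: eq_bigr => i _; rewrite linearZ.
pose M := \matrix_(i, j) mxdot (A (e i)) (A (e j)).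
have AM T j : (T *m M) 0 j = mxdot (A T) (A (e j)).
  rewrite mxE [in RHS]AE mxdot_suml.
  by apply: eq_bigr => i _; rewrite mxdotZl mxE.
have Mfree : row_free M.
  rewrite -kermx_eq0; apply/rowV0P => T /sub_kermxP TM0; apply: Ainj.
  apply/eqP; rewrite -mxdot_eq0 {2}AE mxdotC mxdot_suml big1// => j _.
  by rewrite mxdotZl mxdotC -AM TM0 mxE mulr0.
exists ((\row_j l (e j)) *m invmx M) => Z.
rewrite (AE Z) lE mxdotC mxdot_suml; apply: eq_bigr => j _.
by rewrite mxdotZl mxdotC -AM mulmxKV -?row_free_unit// mxE.
Qed.

(** The uniqueness that accompanies [gram_riesz]. *)
Lemma mxdot_image_inj n p q (A : 'rV[R]_n -> 'M[R]_(p, q)) X Y :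
  (forall k X Y, A (k *: X + Y) = k *: A X + A Y) ->
  (forall X, A X = 0 -> X = 0) ->
  (forall Z, mxdot (A X) (A Z) = mxdot (A Y) (A Z)) -> X = Y.
Proof.
move=> Alin Ainj XY; apply/eqP; rewrite -subr_eq0; apply/eqP/Ainj/eqP.
rewrite -mxdot_eq0.
have AB : A (X - Y) = A X - A Y.
  by rewrite addrC -scaleN1r Alin scaleN1r addrC.
by rewrite {1}AB mxdotBl XY subrr.
Qed.

(* The Levi-Civita connection of the metric induced by a map to a Euclidean
   space is the tangential part of the flat derivative. *)
Lemma christoffel_induced n p q (U : set 'rV[R]_n) (F : 'rV[R]_n -> 'M[R]_(p,
  q))
    (G : 'rV[R]_n -> 'rV[R]_n -> 'rV[R]_n -> R) c y X Y :
  open U -> U y -> class_C 2 U F -> c != 0 ->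
  (forall z X Y, U z -> G z X Y = c * mxdot ('D_X F z) ('D_Y F z)) ->
  (forall X, 'D_X F y = 0 -> X = 0) ->
  forall Z, mxdot ('D_(christoffel G y X Y) F y) ('D_Z F y) =
            mxdot ('D_X ('D_Y F) y) ('D_Z F y).
Proof.
move=> oU Uy F2 c0 GE Finj.
have [Fd FD] := F2.
have dF v : differentiable ('D_v F) y by have [h _] := FD v; exact: h.
have Flin k v w : 'D_(k *: v + w) F y = k *: 'D_v F y + 'D_w F y.
  by apply: derive_linear; exact: Fd.
have [D2 D2E] : exists D2 : 'rV[R]_n -> 'rV[R]_n -> 'M[R]_(p, q),
    forall u v, 'D_u ('D_v F) y = D2 u v by exists (fun u v => 'D_u ('D_v F) y).
have sym u v : D2 u v = D2 v u.
  by rewrite -(D2E u v) -(D2E v u); exact: (derive_comm_mx oU).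
have DG v w u : 'D_u (fun z => G z v w : R^o) y =
    c * (mxdot (D2 u v) ('D_w F y) + mxdot ('D_v F y) (D2 u w)).
  apply: etrans (eq_on_derive oU u (fun z Uz => GE z v w Uz) Uy) _.
  have dd : derivable (fun z => mxdot ('D_v F z) ('D_w F z) : R^o) y u.
    apply: diff_derivable.
    apply: (differentiable_linmx_comp (mxtrace : 'M[R]_p -> R^o)).
    apply: differentiable_mulmx; first exact: dF.
    by apply: (differentiable_linmx_comp trmx); exact: dF.
  apply: etrans (deriveZ c dd) _; congr (c * _).
  by rewrite -(D2E u v) -(D2E u w); exact: derive_mxdot.
have [T TP] : exists T, forall Z, mxdot ('D_T F y) ('D_Z F y) =
    mxdot (D2 X Y) ('D_Z F y).
  apply: (gram_riesz Flin Finj) => k v w.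
  by rewrite Flin mxdotDr mxdotZr.
(* By the product rule each derivative of the metric gives two terms in [D2]. Symmetry of [D2]
   cancels four of the six, and the remaining two are equal. *)
have koszul Z : 2 * (c * mxdot (D2 X Y) ('D_Z F y)) =
    'D_X (fun z => G z Y Z : R^o) y + 'D_Y (fun z => G z X Z : R^o) y
    - 'D_Z (fun z => G z X Y : R^o) y.
  apply: etrans (esym (congr2 (fun a b => a - b)
    (congr2 (fun a b => a + b) (DG Y Z X) (DG X Z Y)) (DG X Y Z))).
  rewrite (sym Y X) (sym Z X) (sym Z Y) (mxdotC ('D_Y F y)) (mxdotC (D2 X Z)).
  by ring.
rewrite /christoffel (D2E X Y) => Z.
have TK : exists T, forall Z, 2 * G y T Z = 'D_X (fun z => G z Y Z : R^o) y
    + 'D_Y (fun z => G z X Z : R^o) y - 'D_Z (fun z => G z X Y : R^o) y.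
  by exists T => W; rewrite -koszul GE// TP.
have /(_ Z) := xgetPex 0 TK; rewrite -koszul GE//.
by move=> /(mulfI _)/(mulfI c0); apply; rewrite pnatr_eq0.
Qed.

End Gradient.

(** * First and second derivatives of a composition *)

Section ChainRule.
Context {R : realType} {n m p q : nat}.
Variables (U : set 'rV[R]_n) (f : 'rV[R]_n -> 'rV[R]_m) (Psi : 'rV[R]_m ->
  'M[R]_(p, q)).
Hypothesis openU : open U.

Lemma derive_comp_row (g : 'rV[R]_m -> 'M[R]_(p, q)) z X :
  differentiable f z -> differentiable g (f z) ->
  'D_X (fun z => g (f z)) z = 'D_('D_X f z) g (f z).
Proof.
move=> fd Pd; have PE : (fun z => g (f z)) = g \o f by [].
rewrite deriveE; last exact: differentiable_comp.
by rewrite PE (diff_comp fd Pd) /= (deriveE _ Pd) (deriveE _ fd).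
Qed.

Lemma derive_row_sum (g : 'rV[R]_m -> 'M[R]_(p, q)) x xi : differentiable g x ->
  'D_xi g x = \sum_i xi 0 i *: 'D_(delta_mx 0 i) g x.
Proof.
move=> gd; rewrite deriveE// {1}(row_sum_delta xi) linear_sum.
by apply: eq_bigr => i _; rewrite linearZ deriveE.
Qed.

(** The direction ['D_Y f] varies with the point. Expanding it in the standard basis writes the
    first derivative as a sum of products [w_i (g_i o f)], with [g_i] the partial derivatives of
    [Psi]; the product rule then separates the two terms. *)
Lemma derive2_comp_row y X Y : U y ->
  class_C 2 U f -> class_C 2 setT Psi ->
  'D_X ('D_Y (fun z => Psi (f z))) y =
  'D_('D_X f y) ('D_('D_Y f y) Psi) (f y) + 'D_('D_X ('D_Y f) y) Psi (f y).
Proof.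
move=> Uy [fd fD] [Pd dPsi].
pose e i : 'rV[R]_m := delta_mx 0 i.
have [g gE] : exists g : 'I_m -> 'rV[R]_m -> 'M[R]_(p, q),
  forall i, g i = 'D_(e i) Psi by exists (fun i => 'D_(e i) Psi).
have gd i x : differentiable (g i) x.
  by rewrite gE; have [h _] := dPsi (e i); exact: h.
have [w wE] : exists w : 'rV[R]_n -> 'rV[R]_m, w = 'D_Y f by exists ('D_Y f).
have wd : differentiable w y by rewrite wE; have [h _] := fD Y; exact: h.
have PsiD xi x : 'D_xi Psi x = \sum_i xi 0 i *: g i x.
  by rewrite derive_row_sum; [under [RHS]eq_bigr do rewrite gE|exact: Pd].
have E z : U z -> 'D_Y (fun z => Psi (f z)) z =
    (\sum_i (fun z => w z 0 i *: g i (f z))) z.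
  move=> Uz; rewrite fct_sumE derive_comp_row ?PsiD ?wE//; first exact: fd.
  exact: Pd.
have wid i : differentiable (fun z => w z 0 i) y.
  exact: ((differentiable_mxP w y).1 wd 0 i).
have gfd i : differentiable (fun z => g i (f z)) y.
  by apply: (@differentiable_comp _ _ _ _ f (g i)); [exact: fd|exact: gd].
rewrite (eq_on_derive openU X E Uy) derive_sum; last first.
  move=> i; apply: diff_derivable.
  by have [] := derive_scalemx 0 (wid i) (gfd i).
have T i : 'D_X (fun z => w z 0 i *: g i (f z)) y =
    'D_X w y 0 i *: g i (f y) + w y 0 i *: 'D_('D_X f y) (g i) (f y).
  have [_ ->] := derive_scalemx X (wid i) (gfd i).
  rewrite (derive_mxE X 0 i wd); congr (_ + _ *: _).
  by apply: derive_comp_row; [exact: fd|exact: gd].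
rewrite (eq_bigr _ (fun i _ => T i)) big_split /= addrC -wE.
have -> : 'D_Y f y = w y by rewrite wE.
congr (_ + _).
  have -> : 'D_(w y) Psi = \sum_i (w y 0 i \*: g i).
    by apply/funext => x; rewrite PsiD fct_sumE.
  rewrite derive_sum => [|i]; last exact/derivableZ/diff_derivable/gd.
  by apply: eq_bigr => i _; rewrite deriveZ//; exact/diff_derivable/gd.
by rewrite PsiD.
Qed.

End ChainRule.

(** * Second fundamental form and shape operator through a map to a Euclidean space *)

Section InducedGeometry.
Context {R : realType} {n m p q : nat}.
Variables (U : set 'rV[R]_n) (f : 'rV[R]_n -> 'rV[R]_m)
  (Psi : 'rV[R]_m -> 'M[R]_(p, q))
  (H : 'rV[R]_m -> 'rV[R]_m -> 'rV[R]_m -> R) (c : R) (y : 'rV[R]_n).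
Hypotheses (openU : open U) (Uy : U y).
Hypotheses (f_smooth : class_C 2 U f) (Psi_smooth : class_C 2 setT Psi)
  (Phi_smooth : class_C 2 U (fun z => Psi (f z))).
Hypothesis c_neq0 : c != 0.
Hypothesis HE : forall x xi eta,
  H x xi eta = c * mxdot ('D_xi Psi x) ('D_eta Psi x).
Hypothesis Psi_inj : forall xi, 'D_xi Psi (f y) = 0 -> xi = 0.
Hypothesis f_inj : forall X, 'D_X f y = 0 -> X = 0.

(* Opaque names for the derivatives at [y]: unification would otherwise unfold
   them. *)
Variables (dPsi : 'rV[R]_m -> 'M[R]_(p, q)) (dPhi : 'rV[R]_n -> 'M[R]_(p, q))
  (ddPhi : 'rV[R]_n -> 'rV[R]_n -> 'M[R]_(p, q)) (df : 'rV[R]_n -> 'rV[R]_m).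
Hypothesis dPsiE : forall xi, 'D_xi Psi (f y) = dPsi xi.
Hypothesis dPhiE : forall X, 'D_X (fun z => Psi (f z)) y = dPhi X.
Hypothesis ddPhiE : forall X Y, 'D_X ('D_Y (fun z => Psi (f z))) y = ddPhi X Y.
Hypothesis dfE : forall X, 'D_X f y = df X.

Let G := pullback_metric H f.

Lemma Psi_differentiable x : differentiable Psi x.
Proof. by have [h _] := Psi_smooth; exact: h. Qed.

Lemma f_differentiable z : U z -> differentiable f z.
Proof. by have [h _] := f_smooth; exact: h. Qed.

Lemma pullback_metricE z X Y : U z -> G z X Y =
  c * mxdot ('D_X (fun z => Psi (f z)) z) ('D_Y (fun z => Psi (f z)) z).
Proof.
move=> Uz; have fd := f_differentiable Uz; have Pd := Psi_differentiable (f z).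
exact: (etrans (HE (f z) ('D_X f z) ('D_Y f z)) (congr1 (fun a => c * a)
  (congr2 mxdot
  (esym (derive_comp_row X fd Pd)) (esym (derive_comp_row Y fd Pd))))).
Qed.

Lemma pullback_metric_at X Y : G y X Y = c * mxdot (dPhi X) (dPhi Y).
Proof. by rewrite pullback_metricE// !dPhiE. Qed.

Lemma ambient_metric_at xi eta : H (f y) xi eta = c * mxdot (dPsi xi) (dPsi
  eta).
Proof. by rewrite HE !dPsiE. Qed.

Lemma dPsi_lin k xi eta : dPsi (k *: xi + eta) = k *: dPsi xi + dPsi eta.
Proof. by rewrite -!dPsiE derive_linear//; exact: Psi_differentiable. Qed.

Lemma dPsiD xi eta : dPsi (xi + eta) = dPsi xi + dPsi eta.
Proof. by rewrite -[xi]scale1r dPsi_lin !scale1r. Qed.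

Lemma dPsiB xi eta : dPsi (xi - eta) = dPsi xi - dPsi eta.
Proof. by rewrite addrC -scaleN1r dPsi_lin scaleN1r addrC. Qed.

Lemma dPsi_inj xi : dPsi xi = 0 -> xi = 0.
Proof. by rewrite -dPsiE; exact: Psi_inj. Qed.

Lemma dPhi_dPsi X : dPhi X = dPsi (df X).
Proof.
rewrite -dPhiE -dPsiE -dfE derive_comp_row//; first exact: f_differentiable.
exact: Psi_differentiable.
Qed.

Lemma df_lin k X Y : df (k *: X + Y) = k *: df X + df Y.
Proof. by rewrite -!dfE derive_linear//; exact: f_differentiable. Qed.

Lemma dPhi_lin k X Y : dPhi (k *: X + Y) = k *: dPhi X + dPhi Y.
Proof. by rewrite !dPhi_dPsi df_lin dPsi_lin. Qed.

Lemma dPhiB X Y : dPhi (X - Y) = dPhi X - dPhi Y.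
Proof. by rewrite addrC -scaleN1r dPhi_lin scaleN1r addrC. Qed.

Lemma dPhi_inj X : dPhi X = 0 -> X = 0.
Proof. by rewrite dPhi_dPsi => /dPsi_inj; rewrite -dfE; exact: f_inj. Qed.

Lemma ddPhiC X Y : ddPhi X Y = ddPhi Y X.
Proof.
by rewrite -(ddPhiE X Y) -(ddPhiE Y X); exact: (derive_comm_mx openU).
Qed.

Lemma ddPhi_lin X k Y Z : ddPhi X (k *: Y + Z) = k *: ddPhi X Y + ddPhi X Z.
Proof.
rewrite !(ddPhiC X) -(ddPhiE (k *: Y + Z) X) -(ddPhiE Y X) -(ddPhiE Z X).
apply: derive_linear.
by have [_ D] := Phi_smooth; have [h _] := D X; exact: h.
Qed.

Lemma christoffel_base X Y Z :
  mxdot (dPhi (christoffel G y X Y)) (dPhi Z) = mxdot (ddPhi X Y) (dPhi Z).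
Proof.
rewrite -(dPhiE (christoffel G y X Y)) -(dPhiE Z) -(ddPhiE X Y).
have Finj V : 'D_V (fun z => Psi (f z)) y = 0 -> V = 0.
  by rewrite dPhiE; exact: dPhi_inj.
exact: (christoffel_induced X Y openU Uy Phi_smooth c_neq0 pullback_metricE
  Finj Z).
Qed.

Lemma christoffelC X Y : christoffel G y X Y = christoffel G y Y X.
Proof.
apply: (mxdot_image_inj dPhi_lin dPhi_inj) => Z.
apply: etrans (christoffel_base X Y Z) _.
apply: etrans _ (esym (christoffel_base Y X Z)).
by rewrite ddPhiC.
Qed.

(** By the chain rule [ddPhi X Y] is the second derivative of [Psi] along [f] plus the image of
    ['D_X ('D_Y f)]. The latter is common to both sides, and the former has the Christoffel term of
    [H] as its tangential part. *)
Lemma ambient_derivative_induced X Y zeta :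
  mxdot (dPsi (ambient_derivative H f y X Y)) (dPsi zeta) =
  mxdot (ddPhi X Y) (dPsi zeta).
Proof.
have E := christoffel_induced ('D_X f y) ('D_Y f y) openT I Psi_smooth c_neq0
  (fun x xi eta _ => HE x xi eta) Psi_inj zeta.
have D2 : ddPhi X Y = 'D_('D_X f y) ('D_('D_Y f y) Psi) (f y) + dPsi ('D_X
  ('D_Y f) y).
  by rewrite -ddPhiE -dPsiE; exact: (derive2_comp_row openU).
rewrite /ambient_derivative dPsiD D2 !mxdotDl addrC; congr (_ + _).
by move: E; rewrite (dPsiE (christoffel _ _ _ _)) (dPsiE zeta).
Qed.

(** The projection is returned together with a preimage [T] in the tangent space of the source,
    characterized by pairings alone, so that it can be identified by [mxdot_image_inj]. *)
Lemma tanproj_induced xi : exists2 T, tanproj H f y xi = df T &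
  forall Z, mxdot (dPhi T) (dPhi Z) = mxdot (dPsi xi) (dPhi Z).
Proof.
have [T TP] : exists T, forall Z, mxdot (dPhi T) (dPhi Z) = mxdot (dPsi xi)
  (dPhi Z).
  apply: (gram_riesz dPhi_lin dPhi_inj) => k X Y.
  by rewrite dPhi_lin mxdotDr mxdotZr.
have ex : exists zeta, (exists X, zeta = 'D_X f y) /\
    forall X, H (f y) (xi - zeta) ('D_X f y) = 0.
  exists (df T); split=> [|X]; first by exists T; rewrite dfE.
  by rewrite ambient_metric_at dfE -dPhi_dPsi dPsiB -dPhi_dPsi mxdotBl -TP
    subrr mulr0.
rewrite /tanproj; have [[S ->] SP] := xgetPex 0 ex; exists S; first exact: dfE.
move=> Z; have := SP Z; rewrite ambient_metric_at !dfE dPsiB -!dPhi_dPsi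
  mxdotBl.
by move=> /eqP; rewrite mulf_eq0 (negbTE c_neq0) subr_eq0 => /eqP.
Qed.

Lemma second_fundamental_form_induced X Y xi :
  H (f y) (second_fundamental_form H f y X Y) (norproj H f y xi) =
  c * mxdot (ddPhi X Y - dPhi (christoffel G y X Y)) (dPsi xi).
Proof.
rewrite /second_fundamental_form /norproj.
have [T -> TP] := tanproj_induced (ambient_derivative H f y X Y).
have [S -> SP] := tanproj_induced xi.
(* The Gauss formula: the tangential part of the ambient derivative is the Levi-Civita connection of
   the induced metric. *)
have <- : T = christoffel G y X Y.
  apply: (mxdot_image_inj dPhi_lin dPhi_inj) => Z.
  apply: etrans (TP Z) (etrans _ (esym (christoffel_base X Y Z))).
  by rewrite dPhi_dPsi ambient_derivative_induced.
rewrite ambient_metric_at !dPsiB -!dPhi_dPsi mxdotBr [X in _ * (_ - X)]mxdotBl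
  -TP subrr subr0.
by rewrite !mxdotBl ambient_derivative_induced.
Qed.

Lemma shape_operator_induced X Y xi :
  G y (shape_operator H f y (norproj H f y xi) Y) X =
  c * mxdot (ddPhi Y X - dPhi (christoffel G y Y X)) (dPsi xi).
Proof.
rewrite -second_fundamental_form_induced.
have [S _ SP] := tanproj_induced xi.
pose l Z := mxdot (ddPhi Y Z - dPhi (christoffel G y Y Z)) (dPsi xi).
(* The Christoffel term pairs with [dPsi xi] as [ddPhi Y Z] pairs with its tangential part. In this
   form linearity in [Z] is inherited from [ddPhi]. *)
have lE Z : l Z = mxdot (ddPhi Y Z) (dPsi xi - dPhi S).
  rewrite /l mxdotBl mxdotBr -christoffel_base; congr (_ - _).
  by rewrite mxdotC -SP mxdotC.
have llin k V W : l (k *: V + W) = k * l V + l W.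
  by rewrite (lE V) (lE W) lE ddPhi_lin mxdotDl mxdotZl.
have [T TP] := gram_riesz dPhi_lin dPhi_inj llin.
have ex : exists T, forall Z, pullback_metric H f y T Z =
    H (f y) (second_fundamental_form H f y Y Z) (norproj H f y xi).
  by exists T => Z; rewrite -/G pullback_metric_at TP
    second_fundamental_form_induced.
by have := xgetPex 0 ex X.
Qed.

Lemma shape_operator_diff X Y xi zeta :
  G y (shape_operator H f y (norproj H f y xi) Y
       - shape_operator H f y (norproj H f y zeta) X) X =
  c * (mxdot (ddPhi Y X - dPhi (christoffel G y Y X)) (dPsi xi)
       - mxdot (ddPhi X X - dPhi (christoffel G y X X)) (dPsi zeta)).
Proof.
by rewrite pullback_metric_at dPhiB mxdotBl mulrBr -!pullback_metric_at
  !shape_operator_induced mulrBr.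
Qed.

End InducedGeometry.

(** * Curvature of a projected connection *)

Section OperatorCalculus.
Context {R : realType} {N d n : nat}.
Variable U : set 'rV[R]_n.
Hypothesis openU : open U.

Lemma derive_opv (M : 'rV[R]_n -> 'M[R]_(N * d)) (s : 'rV[R]_n -> 'M[R]_(N, d))
  y X :
  differentiable M y -> differentiable s y ->
  'D_X (fun z => opv (M z) (s z)) y = opv ('D_X M y) (s y) + opv (M y) ('D_X s
    y).
Proof.
move=> Md sd; have sd' := differentiable_linmx_comp mxvec sd.
rewrite /opv (derive_linmx vec_mx X (differentiable_mulmx sd' Md)).
by rewrite derive_mulmx// (derive_linmx mxvec X sd) linearD addrC.
Qed.

Lemma differentiable_opv (M : 'rV[R]_n -> 'M[R]_(N * d))
    (s : 'rV[R]_n -> 'M[R]_(N, d)) y :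
  differentiable M y -> differentiable s y ->
  differentiable (fun z => opv (M z) (s z)) y.
Proof.
move=> Md sd; have sd' := differentiable_linmx_comp mxvec sd.
exact: (differentiable_linmx_comp vec_mx (differentiable_mulmx sd' Md)).
Qed.

Lemma class_C_opv k (M : 'rV[R]_n -> 'M[R]_(N * d)) (s : 'rV[R]_n -> 'M[R]_(N,
  d)) :
  class_C k U M -> class_C k U s -> class_C k U (fun z => opv (M z) (s z)).
Proof.
move=> MC sC; apply: (class_C_linmx openU vec_mx).
by apply: (class_C_mulmx openU) MC; exact: (class_C_linmx openU mxvec).
Qed.

End OperatorCalculus.

(** * Connection and curvature of a field of orthogonal projections *)

Section ProjectionCurvature.
Context {R : realType} {N d n : nat}.
Variables (U : set 'rV[R]_n) (E : 'rV[R]_n -> set 'M[R]_(N, d))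
  (P : 'rV[R]_n -> 'M[R]_(N * d)).
Hypothesis openU : open U.
Hypothesis PE : forall z w, U z -> orthproj (E z) w = opv (P z) w.
Hypothesis PP : forall z, U z -> P z *m P z = P z.
Hypothesis Ptr : forall z, U z -> (P z)^T = P z.
Hypothesis P_smooth : class_C 3 U P.

Lemma P_differentiable z : U z -> differentiable P z.
Proof. by have [h _] := P_smooth; exact: h. Qed.

Lemma opvP_id z w : U z -> opv (P z) (opv (P z) w) = opv (P z) w.
Proof. by move=> Uz; rewrite -opvM PP. Qed.

(** Differentiated idempotence. It says that the derivative of a projection exchanges its image and
    its kernel. *)
Lemma derive_proj z X : U z -> 'D_X P z = 'D_X P z *m P z + P z *m 'D_X P z.
Proof.
move=> Uz; have Pd := P_differentiable Uz; rewrite -derive_mulmx//.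
by apply: (eq_on_derive openU) => // t Ut; rewrite PP.
Qed.

Lemma derive_proj_tr z X : U z -> ('D_X P z)^T = 'D_X P z.
Proof.
move=> Uz; have Pd := P_differentiable Uz; rewrite -(derive_linmx trmx X Pd).
by apply: (eq_on_derive openU) => // t Ut; rewrite Ptr.
Qed.

Lemma nabla_proj X s z : U z -> nabla E X s z = opv (P z) ('D_X s z).
Proof. by move=> Uz; rewrite /nabla PE. Qed.

Lemma class_C_nabla k X s : (k <= 3)%N -> class_C k.+1 U s ->
  class_C k U (nabla E X s).
Proof.
move=> k3 [_ sD].
have PC : class_C k U P.
  have P2 := class_CW P_smooth; have P1 := class_CW P2.
  by case: k k3 {sD} => [|[|[|[|//]]]] _ //; exact: class_CW P1.
apply: (class_C_eq openU) (class_C_opv openU PC (sD X)) => z Uz.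
by rewrite nabla_proj.
Qed.

Section AtPoint.
Variables (y : 'rV[R]_n) (dP : 'rV[R]_n -> 'M[R]_(N * d)).
Hypothesis Uy : U y.
Hypothesis dPE : forall X, 'D_X P y = dP X.
Local Notation p := (P y).

Lemma dP_swap X w : opv (dP X) (opv p w) = opv (dP X) w - opv p (opv (dP X) w).
Proof.
rewrite -!opvM -opvBl; congr (opv _ _); apply/esym/eqP; rewrite subr_eq addrC.
by apply/eqP; rewrite -dPE; exact: derive_proj.
Qed.

Lemma dP_compress X w : opv p (opv (dP X) (opv p w)) = 0.
Proof. by rewrite dP_swap opvBr opvP_id// subrr. Qed.

(** Each derivative of the projection is off-diagonal for the splitting into image and kernel, so a
    product of two of them is block diagonal. *)
Lemma dP2_comm X Y w :
  opv (dP X) (opv (dP Y) (opv p w)) = opv p (opv (dP X) (opv (dP Y) w)).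
Proof. by rewrite dP_swap opvBr dP_swap subKr. Qed.

Lemma nabla_nabla X Y s : class_C 2 U s ->
  nabla E X (nabla E Y s) y =
  opv p (opv (dP X) ('D_Y s y)) + opv p ('D_X ('D_Y s) y).
Proof.
move=> [_ sD].
have dY : differentiable ('D_Y s) y by have [h _] := sD Y; exact: h.
rewrite nabla_proj//.
have -> : 'D_X (nabla E Y s) y = 'D_X (fun z => opv (P z) ('D_Y s z)) y.
  by apply: (eq_on_derive openU) => // z Uz; exact: nabla_proj.
rewrite (derive_opv X (P_differentiable Uy) dY) opvDr opvP_id// dPE.
by [].
Qed.

(** Differentiation of [P s = s]: the part of the derivative normal to the fiber depends only on the
    value of the section. *)
Lemma derive_section X s : (forall z, U z -> opv (P z) (s z) = s z) ->
  differentiable s y -> opv (dP X) (s y) + opv p ('D_X s y) = 'D_X s y.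
Proof.
move=> sP sd; rewrite -dPE -(derive_opv X (P_differentiable Uy) sd).
exact: (eq_on_derive openU).
Qed.

(** The second derivatives of [s] cancel by symmetry. In the first-order terms the fiber component
    of the derivative of [s] is killed by [dP_compress], and [derive_section] gives the rest from
    the value of [s] at [y]. *)
Lemma curvature_proj X Y s : class_C 2 U s ->
  (forall z, U z -> opv (P z) (s z) = s z) ->
  curvature E X Y s y = opv p (opv (dP X) (opv (dP Y) (s y))
                               - opv (dP Y) (opv (dP X) (s y))).
Proof.
move=> s2 sP; have [sd _] := s2.
have S Z : opv p (opv (dP Z) ('D_X s y)) = opv p (opv (dP Z) (opv (dP X) (s
  y))).
  by rewrite -{1}(derive_section X sP (sd y Uy)) !opvDr dP_compress addr0.
have T Z : opv p (opv (dP Z) ('D_Y s y)) = opv p (opv (dP Z) (opv (dP Y) (s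
  y))).
  by rewrite -{1}(derive_section Y sP (sd y Uy)) !opvDr dP_compress addr0.
apply: etrans (congr2 (fun a b => a - b) (nabla_nabla X Y s2) (nabla_nabla Y X
  s2)) _.
rewrite S T (derive_comm_mx openU Y X s2 Uy) opvBr opprD addrACA subrr addr0.
by [].
Qed.

End AtPoint.

Section CurvatureTensors.
Variables (y : 'rV[R]_n) (dP : 'rV[R]_n -> 'M[R]_(N * d)).
Hypothesis Uy : U y.
Hypothesis dPE : forall X, 'D_X P y = dP X.
Local Notation p := (P y).
Variables (G : 'rV[R]_n -> 'rV[R]_n -> 'rV[R]_n -> R) (W V : 'M[R]_(N, d)).
Variable ddP : 'rV[R]_n -> 'rV[R]_n -> 'M[R]_(N * d).
Hypothesis ddPE : forall X Y, 'D_X ('D_Y P) y = ddP X Y.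
Hypotheses (pW : opv p W = W) (pV : opv p V = V).

Definition commform (A B : 'M[R]_(N * d)) (W V : 'M[R]_(N, d)) : R :=
  mxdot (opv A (opv B W)) V - mxdot (opv B (opv A W)) V.

Lemma commformDl A A' B : commform (A + A') B W V = commform A B W V + commform
  A' B W V.
Proof. by rewrite /commform !opvDl opvDr !mxdotDl opprD addrACA. Qed.

Lemma commformC A B : commform A B W V = - commform B A W V.
Proof. by rewrite /commform opprB. Qed.

Lemma commformNl A B : commform (- A) B W V = - commform A B W V.
Proof. by rewrite /commform !opvNl opvNr !mxdotNl opprB opprK addrC. Qed.

Lemma commformBl A A' B : commform (A - A') B W V = commform A B W V - commform
  A' B W V.
Proof. by rewrite commformDl commformNl. Qed.

Lemma commformBr A B B' : commform A (B - B') W V = commform A B W V - commform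
  A B' W V.
Proof. by rewrite !(commformC A) commformBl opprB opprK addrC. Qed.

Lemma mxdot_pV w : mxdot (opv p w) V = mxdot w V.
Proof. by rewrite mxdot_opv Ptr// pV. Qed.

Lemma extension_section z : U z -> opv (P z) (extension E W z) = extension E W
  z.
Proof. by move=> Uz; rewrite /extension PE// opvP_id. Qed.

Lemma extension_smooth : class_C 3 U (extension E W).
Proof.
apply: (class_C_eq openU) (class_C_opv openU P_smooth (class_C_cst U 3 W)).
by move=> z Uz; rewrite /extension PE.
Qed.

Lemma extension_at : extension E W y = W.
Proof. by rewrite /extension PE. Qed.

Lemma derive_extension X : 'D_X (extension E W) y = opv (dP X) W.
Proof.
have -> : 'D_X (extension E W) y = 'D_X (fun z => opv (P z) W) y.
  by apply: (eq_on_derive openU) => // z Uz; rewrite /extension PE.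
have cd : differentiable (fun=> W : 'M[R]_(N, d)) y by exact:
  differentiable_cst.
rewrite (derive_opv X (P_differentiable Uy) cd) derive_cst dPE.
by rewrite opv0r addr0.
Qed.

Lemma curvature_extension X Y :
  mxdot (curvature E X Y (extension E W) y) V = commform (dP X) (dP Y) W V.
Proof.
have s2 := class_CW extension_smooth.
rewrite (curvature_proj Uy dPE X Y s2 extension_section) extension_at.
by rewrite mxdot_pV mxdotBl.
Qed.

(** The extension of [W] by projection is parallel at [y], since its derivative there is normal to
    the fiber; the curvature sees only the value of a section. *)
Lemma curvature_nabla_extension X Y Z :
  curvature E X Y (nabla E Z (extension E W)) y = 0.
Proof.
have s2 : class_C 2 U (nabla E Z (extension E W)).
  exact: class_C_nabla extension_smooth.
have s0 : nabla E Z (extension E W) y = 0.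
  by rewrite nabla_proj// derive_extension -{1}pW (dP_compress Uy dPE).
rewrite (curvature_proj Uy dPE X Y s2); last first.
  by move=> z Uz; rewrite nabla_proj// opvP_id.
by rewrite s0 !opv0r subrr opv0r.
Qed.

(** Only the derivatives of the two factors ['D_X P] and ['D_Y P] survive. Differentiating the outer
    projection, or the section, leaves an odd number of off-diagonal operators between vectors of
    the fiber, which pairs to 0. *)
Lemma nabla_curvature Z X Y :
  mxdot (nabla E Z (curvature E X Y (extension E W)) y) V =
  commform (ddP Z X) (dP Y) W V + commform (dP X) (ddP Z Y) W V.
Proof.
set s := extension E W.
have [s3d s3D] := extension_smooth.
have sd : differentiable s y by exact: s3d.
have sy : s y = W := extension_at.
have sD : 'D_Z s y = opv (dP Z) W := derive_extension Z.
have [Pd dPd] := P_smooth.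
have dd T : differentiable ('D_T P) y by have [h _] := dPd T; exact: h.
have [K KE] : exists K, K = fun z => opv ('D_X P z) (opv ('D_Y P z) (s z))
    - opv ('D_Y P z) (opv ('D_X P z) (s z)) by eexists.
have dXY T T' : differentiable (fun z => opv ('D_T P z) (opv ('D_T' P z) (s
  z))) y.
  exact: differentiable_opv (dd T) (differentiable_opv (dd T') sd).
have Kd : differentiable K y by rewrite KE; exact: differentiableB.
have Ky : K y = opv (dP X) (opv (dP Y) W) - opv (dP Y) (opv (dP X) W).
  by rewrite KE !dPE sy.
have KP : K y = opv p (K y).
  by rewrite Ky opvBr -!(dP2_comm Uy dPE) pW.
have DXY T T' : 'D_Z (fun z => opv ('D_T P z) (opv ('D_T' P z) (s z))) y =
    opv (ddP Z T) (opv (dP T') W) + (opv (dP T) (opv (ddP Z T') W)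
    + opv (dP T) (opv (dP T') (opv (dP Z) W))).
  rewrite (derive_opv Z (dd T) (differentiable_opv (dd T') sd)).
  rewrite (derive_opv Z (dd T') sd) sD sy.
  by rewrite !dPE (ddPE Z T) (ddPE Z T') opvDr.
have DK : 'D_Z K y =
    (opv (ddP Z X) (opv (dP Y) W) + (opv (dP X) (opv (ddP Z Y) W)
     + opv (dP X) (opv (dP Y) (opv (dP Z) W))))
    - (opv (ddP Z Y) (opv (dP X) W) + (opv (dP Y) (opv (ddP Z X) W)
       + opv (dP Y) (opv (dP X) (opv (dP Z) W)))).
  rewrite KE; apply: etrans (deriveB _ _) _; try exact: diff_derivable.
  exact: (congr2 (fun a b => a - b) (DXY X Y) (DXY Y X)).
have vanish T T' : mxdot (opv (dP T) (opv (dP T') (opv (dP Z) W))) V = 0.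
  rewrite -mxdot_pV -(dP2_comm Uy dPE); have := dP_compress Uy dPE Z W; rewrite
    pW => ->.
  by rewrite !opv0r mxdot0l.
rewrite nabla_proj// mxdot_pV.
have -> : 'D_Z (curvature E X Y s) y = 'D_Z (fun z => opv (P z) (K z)) y.
  apply: (eq_on_derive openU) => // z Uz; rewrite KE.
  exact: (curvature_proj Uz (fun _ => erefl) X Y (class_CW extension_smooth)
          extension_section).
rewrite (derive_opv Z (Pd y Uy) Kd) dPE mxdotDl mxdot_pV {1}KP -mxdot_pV.
rewrite (dP_compress Uy dPE) mxdot0l add0r DK mxdotBl !mxdotDl (vanish X Y)
  (vanish Y X).
by rewrite !addr0 /commform; ring.
Qed.

Lemma curvature_derivative_proj Z X Y :
  mxdot (curvature_derivative E G y Z X Y W) V =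
  commform (ddP Z X - dP (christoffel G y Z X)) (dP Y) W V
  + commform (dP X) (ddP Z Y - dP (christoffel G y Z Y)) W V.
Proof.
have aux (n0 c1 c2 c3 : 'M[R]_(N, d)) x0 x1 x2 : mxdot n0 V = x0 ->
    mxdot c1 V = x1 -> mxdot c2 V = x2 -> c3 = 0 ->
    mxdot (n0 - c1 - c2 - c3) V = x0 - x1 - x2.
  by move=> <- <- <- ->; rewrite subr0 !mxdotBl.
apply: etrans (aux _ _ _ _ _ _ _ (nabla_curvature Z X Y)
  (curvature_extension _ Y) (curvature_extension X _)
  (curvature_nabla_extension X Y Z)) _.
by rewrite commformBl commformBr; ring.
Qed.

End CurvatureTensors.

End ProjectionCurvature.

(** * Affine charts of the projective space *)

Section AffineChart.
Context {R : realType} {K : scalars} {N : nat}.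
Local Notation d := (dimK K).
Local Notation m := (N.-1 * d)%N.

Lemma class_C_projmx k n (U : set 'rV[R]_n) (v : 'rV[R]_n -> 'M[R]_(N, d)) :
  open U -> (forall z, U z -> v z != 0) -> class_C k U v ->
  class_C k U (fun z => projmx (v z)).
Proof.
move=> oU v0 vC.
pose h z := mxvec (v z) *m (mxvec (v z))^T.
have hE z : h z 0 0 = mxdot (v z) (v z) by rewrite /h mxdot_row mxdot_mxvec mxE.
have mvC : class_C k U (fun z => mxvec (v z)) by exact: (class_C_linmx oU
  mxvec).
have hC : class_C k U h.
  by apply: (class_C_mulmx oU mvC); exact: (class_C_linmx oU trmx).
have hiC : class_C k U (fun z => (h z 0 0)^-1%:M : 'M[R]_1).
  by apply: (class_C_inv oU) hC => z Uz; rewrite hE mxdot_eq0 v0.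
have rC l : class_C k U (fun z => mxvec (v z *m rho (delta_mx 0 l))).
  apply: (class_C_linmx oU mxvec).
  exact: (class_C_linmx oU (mulmxr (rho (delta_mx 0 l)))).
pose Q z := \sum_l (mxvec (v z *m rho (delta_mx 0 l)))^T
  *m ((h z 0 0)^-1)%:M *m mxvec (v z *m rho (delta_mx 0 l)).
have QC : class_C k U Q.
  apply: (class_C_sum oU) => l; apply: (class_C_mulmx oU) (rC l).
  by apply: (class_C_mulmx oU) hiC; exact: (class_C_linmx oU trmx).
apply: (class_C_eq oU) QC => z _.
by rewrite /Q /projmx; apply: eq_bigr => l _; rewrite hE.
Qed.

(** For fixed [w] and [a], K-linearity is a linear condition on the operator, so it can be
    differentiated. *)
Lemma derive_klinear n (M : 'rV[R]_n -> 'M[R]_(N * d)) (U : set 'rV[R]_n) y X :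
  open U -> U y -> (forall z, U z -> klinear (M z)) -> differentiable M y ->
  klinear ('D_X M y).
Proof.
move=> oU Uy Ml Md w a.
have D u : 'D_X (fun z => opv (M z) u) y = opv ('D_X M y) u.
  have cd : differentiable (fun=> u : 'M[R]_(N, d)) y by exact:
    differentiable_cst.
  by rewrite (derive_opv X Md cd) derive_cst opv0r addr0.
have cw : differentiable (fun z => opv (M z) w) y.
  apply: (differentiable_opv Md); exact: differentiable_cst.
have DR := derive_linmx (mulmxr (rho a)) X cw; rewrite /= in DR.
rewrite -(D w) -(D (w *m rho a)) -DR.
by apply: (eq_on_derive oU) => // z Uz; rewrite Ml.
Qed.

Variable j : 'I_N.
Local Notation vec := (@insert_row R K N j (kone K)).
Local Notation vec0 := (@insert_row R K N j 0).

Lemma insert_row_linear : linear (@insert_row R K N j 0).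
Proof.
move=> k x y; apply/matrixP => i l; rewrite !mxE; case: unliftP => [i' _|_].
  by rewrite !mxE.
by rewrite !mxE mulr0 addr0.
Qed.

HB.instance Definition _ := GRing.isLinear.Build R _ _ _
  (@insert_row R K N j 0) insert_row_linear.

Lemma insert_rowD a x : @insert_row R K N j a x = insert_row j a 0 + vec0 x.
Proof.
apply/matrixP => i l; rewrite !mxE; case: unliftP => [i' _|_].
  by rewrite !mxE add0r.
by rewrite mxE addr0.
Qed.

Lemma row_insert_row a x : row j (@insert_row R K N j a x) = a.
Proof. by apply/rowP => l; rewrite !mxE unlift_none. Qed.

Lemma row'_insert_row a x : row' j (@insert_row R K N j a x) = vec_mx x.
Proof. by apply/matrixP => i l; rewrite !mxE liftK !mxE. Qed.

Lemma insert_row_row' (w : 'M[R]_(N, d)) : insert_row j (row j w) (mxvec (row'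
  j w)) = w.
Proof.
apply/row_matrixP => i; rewrite rowK mxvecK.
by case: unliftP => [i' ->|-> //]; apply/rowP => l; rewrite !mxE.
Qed.

Lemma insert_row_scale x a : vec0 (mxvec (vec_mx x *m rho a)) = vec0 x *m rho a.
Proof.
apply/row_matrixP => i; rewrite row_mul !rowK mxvecK.
by case: unliftP => [i' _|_]; rewrite ?row_mul// mul0mx.
Qed.

Lemma kone_neq0 : kone K != 0 :> 'rV[R]_d.
Proof.
apply/eqP => /rowP /(_ ord0) /eqP; rewrite !mxE !eqxx /=.
by rewrite oner_eq0.
Qed.

Lemma vec_neq0 x : vec x != 0.
Proof.
apply: contra_neq kone_neq0 => v0; by rewrite -(row_insert_row (kone K) x) v0
  linear0.
Qed.

Lemma class_C_vec k (n : nat) (U : set 'rV[R]_n) (f : 'rV[R]_n -> 'rV[R]_m) :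
  open U -> class_C k U f -> class_C k U (fun z => vec (f z)).
Proof.
move=> oU fC; have E z : vec (f z) = insert_row j (kone K) 0 + vec0 (f z).
  exact: insert_rowD.
apply: (class_C_eq oU) (class_CD oU (class_C_cst U k (insert_row j (kone K) 0))
  (class_C_linmx oU (@insert_row R K N j 0) fC)) => z _.
by rewrite E.
Qed.

End AffineChart.

(** * Real and imaginary parts of scalars *)

Section ImaginaryScalars.
Context {R : realType} {K : scalars}.
Local Notation d := (dimK K).
Implicit Types (a b c : 'rV[R]_d) (q : 'rV[R]_(nimag K)).

Definition imag q : 'rV[R]_d := \sum_s q 0 s *: kunit s.
Definition impart a : 'rV[R]_(nimag K) := \row_s a 0 (lift ord0 s).

Lemma imagE q l : imag q 0 l = if unlift ord0 l is Some s then q 0 s else 0.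
Proof.
rewrite /imag summxE; case: unliftP => [s ->|->].
  rewrite (bigD1 s)//= big1 ?addr0 => [|t ts]; rewrite !mxE ?eqxx ?mulr1//.
  by rewrite (inj_eq lift_inj) eq_sym (negbTE ts) mulr0.
by rewrite big1// => s _; rewrite !mxE -val_eqE /= mulr0.
Qed.

Lemma impartK a : a = a 0 ord0 *: kone K + imag (impart a).
Proof.
apply/rowP => l; rewrite !mxE imagE; case: unliftP => [s ->|->].
  by rewrite !mxE /= mulr0 add0r.
by rewrite eqxx /= mulr1 addr0.
Qed.

Lemma imag0 q : imag q 0 ord0 = 0.
Proof. by rewrite imagE unlift_none. Qed.

Lemma mxdot_imag q : mxdot (imag q) (imag q) = mxdot q q.
Proof.
rewrite !mxdotE !big_ord1 big_ord_recl imag0 mul0r add0r.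
by apply: eq_bigr => s _; rewrite imagE liftK.
Qed.

Lemma imagZ k q : imag (k *: q) = k *: imag q.
Proof.
by rewrite /imag scaler_sumr; apply: eq_bigr => s _; rewrite mxE scalerA.
Qed.

Lemma rho_imag_tr q : (rho (imag q))^T = - rho (imag q).
Proof.
by apply/eqP; rewrite -addr_eq0 addrC rho_tr imag0 mulr0 raddf0.
Qed.

Lemma rho_skew c : rho c - (rho c)^T = 2 *: rho (imag (impart c)).
Proof.
rewrite {1 2}(impartK c) rhoD rhoZ rho1 linearD /= rho_imag_tr scalemx1
  tr_scalar_mx.
by rewrite opprD opprK addrACA subrr add0r scaler_nat mulr2n.
Qed.

Lemma mxdot_kconj b : mxdot (kconj b) (kconj b) = mxdot b b.
Proof.
have k1 : mxdot (kone K) (kone K) = 1 :> R by exact: mxdot_delta.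
have kb : mxdot (kone K) b = b 0 ord0.
  rewrite mxdotE big_ord1 (bigD1 ord0)//= big1 ?mxE ?eqxx ?mul1r ?addr0// => l
    l0.
  by rewrite !mxE (negbTE l0) mul0r.
rewrite /kconj mxdotBl !mxdotBr !mxdotZl !mxdotZr (mxdotC b) k1 kb; ring.
Qed.

(** The scalar is [c = a b^*]. For orthogonal [a] and [b] it is purely imaginary, of norm the
    product of theirs, which is what the strict case requires. *)
Lemma rho_commutator a b : exists c,
  [/\ rho a *m (rho b)^T - rho b *m (rho a)^T = 2 *: rho (imag (impart c)),
      c 0 ord0 = mxdot a b & mxdot c c = mxdot a a * mxdot b b].
Proof.
have rc : rho (a *m rho (kconj b)) = rho a *m (rho b)^T by rewrite -rhoM
  rho_conj.
exists (a *m rho (kconj b)); split.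
- by rewrite -rho_skew rc trmx_mul trmxK.
- have := rho_tr (a *m rho (kconj b)); rewrite rc trmx_mul trmxK rho_polar.
  move=> /matrixP /(_ ord0 ord0); rewrite !mxE eqxx !mulr1n.
  have n2 : 2 != 0 :> R by rewrite pnatr_eq0.
  by move=> /(mulfI n2) ->.
- by rewrite mxdot_mulmx -mulmxA rho_norm mul_mx_scalar mxdotZr mxdot_kconj
  mulrC.
Qed.

End ImaginaryScalars.

(** * The Fubini-Study metric and the almost complex structures in terms of projections *)

Section FubiniStudy.
Context {R : realType} {K : scalars} {N : nat}.
Variable j : 'I_N.
Local Notation d := (dimK K).
Local Notation m := (N.-1 * d)%N.
Local Notation vec := (@insert_row R K N j (kone K)).
Local Notation vec0 := (@insert_row R K N j 0).

Definition affproj (x : 'rV[R]_m) : 'M[R]_(N * d) := projmx (vec x).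

Lemma class_C_affproj_comp k n (U : set 'rV[R]_n) (f : 'rV[R]_n -> 'rV[R]_m) :
  open U -> class_C k U f -> class_C k U (fun z => affproj (f z)).
Proof.
move=> oU fC; apply: (class_C_projmx oU (v := fun z => vec (f z))).
  by move=> z _; exact: vec_neq0.
exact: class_C_vec.
Qed.

Lemma class_C_id k n (U : set 'rV[R]_n) : class_C k U (fun x : 'rV[R]_n => x).
Proof.
case: k => [|k]; first by move=> x _; exact: cvg_id.
split=> [x _|v]; first exact: (@ex_diff _ _ _ _ _ _ _ (is_diff_id x)).
have -> : 'D_v (fun x : 'rV[R]_n => x) = (fun=> v).
  by apply/funext => x; exact: derive_id.
exact: class_C_cst.
Qed.

Lemma affproj_smooth k : class_C k setT affproj.
Proof. exact: (class_C_affproj_comp openT (class_C_id k setT)). Qed.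

Lemma affproj_differentiable x : differentiable affproj x.
Proof. by have [h _] := affproj_smooth 1; exact: h. Qed.

(** Obtained by differentiating the identity that the projection fixes [vec x]. The right side is
    the homomorphism that represents the tangent vector [xi] in the definition of the metric. *)
Lemma derive_affproj_vec x xi :
  opv ('D_xi affproj x) (vec x) = vec0 xi - opv (affproj x) (vec0 xi).
Proof.
have vd : differentiable vec x.
  have [h _] : class_C 1 setT vec := class_C_vec j openT (@class_C_id 1 m setT).
  exact: h.
have Dv : 'D_xi vec x = vec0 xi.
  have idd : differentiable (fun x : 'rV[R]_m => x) x.
    by have [h _] := @class_C_id 1 m setT; exact: h.
  have Ld := differentiable_linmx_comp (@insert_row R K N j 0) idd.
  have -> : vec = (fun=> insert_row j (kone K) 0) + (fun x => vec0 x).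
    by apply/funext => z; rewrite insert_rowD.
  rewrite deriveD; [|exact: derivable_cst|exact: diff_derivable].
  rewrite derive_cst add0r.
  apply: etrans (derive_linmx (@insert_row R K N j 0) xi idd) _.
  by rewrite derive_id.
have := derive_opv xi (affproj_differentiable x) vd.
have -> : (fun z => opv (affproj z) (vec z)) = vec.
  apply/funext => z; apply: projmx_id; [exact: vec_neq0|exact: kline_id].
by rewrite Dv => {1}->; rewrite addrK.
Qed.

Lemma derive_affproj_klinear x xi : klinear ('D_xi affproj x).
Proof.
apply: (derive_klinear xi openT I _ (affproj_differentiable x)) => z _.
exact/projmx_klinear/vec_neq0.
Qed.

Lemma derive_affproj_tr x xi : ('D_xi affproj x)^T = 'D_xi affproj x.
Proof.
apply: (derive_proj_tr openT _ (affproj_smooth 3) xi I) => z _; exact: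
  projmx_tr.
Qed.

Lemma derive_affproj_offdiag x xi : 'D_xi affproj x =
  'D_xi affproj x *m affproj x + affproj x *m 'D_xi affproj x.
Proof.
apply: (derive_proj openT _ (affproj_smooth 3) xi I) => z _.
exact/projmx_idem/vec_neq0.
Qed.

(** By [mxtrace_offdiag] the trace pairing is [2 d / |v|^2] times the pairing of the values at the
    spanning vector [v], which explains the constant. *)
Lemma fubini_studyE scale x xi eta : fubini_study scale j x xi eta =
  scale / (2 * d%:R) * mxdot ('D_xi affproj x) ('D_eta affproj x).
Proof.
rewrite /fubini_study !orthproj_line ?vec_neq0//.
rewrite -/(affproj x) -!derive_affproj_vec.
rewrite [in RHS]/mxdot derive_affproj_tr (mxtrace_offdiag (vec_neq0 j x)).
- move: (mxdot _ _) (vec_neq0 j x) => t; rewrite -mxdot_eq0.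
  have : d%:R != 0 :> R by rewrite pnatr_eq0.
  move: (d%:R : R) (mxdot (vec x) (vec x)) => e r e0 r0.
  by field; rewrite r0 e0.
- exact: derive_affproj_klinear.
- exact: derive_affproj_klinear.
- exact: derive_affproj_tr.
- exact: derive_affproj_tr.
- exact: derive_affproj_offdiag.
Qed.

(** If the derivative vanishes, then [insert_row j 0 xi] lies on the line of [vec x]. Row [j] of the
    former is 0 and of the latter is 1, so the scalar relating them is 0. *)
Lemma derive_affproj_inj x xi : 'D_xi affproj x = 0 -> xi = 0.
Proof.
move=> D0; have := derive_affproj_vec x xi; rewrite D0.
have -> : opv 0 (vec x) = 0 by rewrite /opv mulmx0 linear0.
move=> /esym/eqP; rewrite subr_eq0 => /eqP xiE.
have [a aE] := (kline_rho _ _).1 (projmx_line (vec x) (vec0 xi)).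
have xia : vec0 xi = vec x *m rho a by rewrite xiE.
have a0 : rho a = 0.
  rewrite -[LHS]mul1mx -rho1 rhoM.
  by have := row_insert_row j 0 xi; rewrite xia row_mul row_insert_row => ->;
    rewrite rho0.
rewrite -[LHS]vec_mxK -(row'_insert_row j 0 xi) xia a0 mulmx0.
by rewrite !linear0.
Qed.

Lemma span_structureE q xi :
  span_structure q xi = mxvec (vec_mx xi *m rho (imag q)) :> 'rV[R]_m.
Proof.
rewrite /span_structure /imag rho_sum mulmx_sumr linear_sum.
apply: eq_bigr => s _; rewrite rhoZ -scalemxAr linearZ /=; congr (_ *: _).
by rewrite /almost_structure kscaleE.
Qed.

(** Scalar multiplication of chart coordinates survives the projection to the orthogonal complement,
    which is K-linear. This matches the structure [q] with the scalar [imag q]. *)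
Lemma derive_affproj_span x xi q :
  opv ('D_(span_structure q xi) affproj x) (vec x) =
  opv ('D_xi affproj x) (vec x) *m rho (imag q).
Proof.
apply: etrans (derive_affproj_vec x _) _.
apply: etrans _ (esym (congr1 (mulmx^~ (rho (imag q))) (derive_affproj_vec x
  xi))).
rewrite span_structureE insert_row_scale mulmxBl; congr (_ - _).
exact/projmx_klinear/vec_neq0.
Qed.

End FubiniStudy.

(** * Comparison of the two inequalities *)

Section LocalPicture.
Context {R : realType} {K : scalars} {N n : nat} {B : topologicalType}.
Local Notation d := (dimK K).

(** Near a point of the image, the image of [O] contains the part of the preimage of [O] under
    [cinv] that lies in the open image of the chart. *)
Lemma chart_image_open (x : chart R n B) (O : set B) :
  open O -> O `<=` cdom x -> open (cmap x @` O).
Proof.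
move=> oO Ox; rewrite openE => _ [p Op <-].
have Ip : (cmap x @` cdom x) (cmap x p) by exists p => //; exact: Ox.
have nI : nbhs (cmap x p) (cmap x @` cdom x) := open_nbhs_nbhs (conj
  (@cimg_open _ _ _ x) Ip).
have nO : nbhs (cmap x p) (cinv x @^-1` O).
  apply: (cinv_continuous Ip); rewrite (cmapK (Ox _ Op)); exact: open_nbhs_nbhs.
apply: filterS (filterI nI nO) => _ [[r rx <-]] /=; rewrite (cmapK rx) => rO.
by exists r.
Qed.

Lemma line_of_affine (j : 'I_N) (sigma : KP R K N) : affine_dom j sigma ->
  line_of sigma = kline (insert_row j (kone K) (affine_coord j sigma)).
Proof.
move=> [w sw wj]; have [v v0 sE] := line_ofP sigma.
have ex : exists w, line_of sigma w /\ row j w = kone K by exists w.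
rewrite /affine_coord; set u := xget _ _.
have [su uj] : line_of sigma u /\ row j u = kone K := xgetPex 0 ex.
rewrite -uj insert_row_row' sE; apply/esym/kline_sym; last by rewrite -sE.
by apply: contra_neq (@kone_neq0 R K) => u0; rewrite -uj u0 linear0.
Qed.

Variables (A : set (chart R n B)) (phi : B -> KP R K N) (x : chart R n B) (j :
  'I_N).
Hypothesis phi_imm : immersion A phi.
Hypothesis Ax : A x.
Local Notation U := (cmap x @` (cdom x `&` phi @^-1` affine_dom j)).
Local Notation f := (local_map phi x j).

Lemma local_domain_open : open U.
Proof.
have [/(_ _ j Ax)[oO _] _] := phi_imm.
exact: (chart_image_open oO (fun p h => proj1 h)).
Qed.

Lemma local_map_smooth k : class_C k U f.
Proof. by have [/(_ _ j Ax)[_ h] _] := phi_imm; exact: h. Qed.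

Lemma fiber_local z : U z -> fiber phi x z = kline (insert_row j (kone K) (f
  z)).
Proof.
by move=> [p [px pj] <-]; rewrite /fiber /local_map (cmapK px); exact:
  line_of_affine.
Qed.

Section Comparison.
Variables (scale : R) (p : B) (a b : 'rV[R]_d) (q : 'rV[R]_(nimag K)) (t : R).
Hypothesis scale_gt0 : 0 < scale.
Hypotheses (px : cdom x p) (pj : affine_dom j (phi p)).
Hypothesis abq : rho a *m (rho b)^T - rho b *m (rho a)^T = t *: rho (imag q).
Local Notation y := (cmap x p).
Local Notation v := (insert_row j (kone K) (f y)).
Local Notation W := (v *m rho a).
Local Notation V := (v *m rho b).
Local Notation H := (fubini_study scale j).
Local Notation c := (scale / (2 * d%:R)).
Local Notation kappa := (t * (mxdot v v / (2 * d%:R))).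

Let Uy : U y. Proof. by exists p. Qed.

Let c_neq0 : c != 0.
Proof. by rewrite mulf_neq0 ?gt_eqF// invr_gt0 mulr_gt0 ?ltr0n. Qed.

(** In [kappa], the factor [t] comes from the commutator of scalars and [mxdot v v / (2 * d%:R)]
    from inverting the trace formula [mxtrace_offdiag]. *)
Lemma commform_span (S : 'M[R]_(N * d)) (xi : 'rV[R]_(N.-1 * d)) :
  klinear S -> S^T = S ->
  commform S ('D_xi (@affproj R K N j) (f y)) W V =
  kappa * mxdot S ('D_(span_structure q xi) (@affproj R K N j) (f y)).
Proof.
move=> Sl Ss.
have Bl := derive_affproj_klinear j (f y); have Bs := derive_affproj_tr j (f y).
apply: etrans (mxdot_commutator v Sl (Bl xi) Ss (Bs xi) abq) _.
have -> : opv ('D_xi (@affproj R K N j) (f y)) v *m rho (imag q) =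
    opv ('D_(span_structure q xi) (@affproj R K N j) (f y)) v.
  exact: esym (derive_affproj_span j (f y) xi q).
have trE := mxtrace_offdiag (vec_neq0 j (f y)) (Bl (span_structure q xi)) Sl
  (Bs _) Ss (derive_affproj_offdiag _ _ _).
have -> : mxdot S ('D_(span_structure q xi) (@affproj R K N j) (f y)) =
    \tr ('D_(span_structure q xi) (@affproj R K N j) (f y) *m S).
  by rewrite mxdotC /mxdot Ss.
rewrite trE; move: (mxdot (opv _ _) _) (vec_neq0 j (f y)) => s.
rewrite -mxdot_eq0; have : d%:R != 0 :> R by rewrite pnatr_eq0.
move: (d%:R : R) (mxdot v v) => e r e0 r0.
by field; rewrite r0 e0.
Qed.

Lemma derive_fixed_tr (M : 'rV[R]_n -> 'M[R]_(N * d)) X :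
  (forall z, U z -> (M z)^T = M z) -> differentiable M y -> ('D_X M y)^T = 'D_X
    M y.
Proof.
move=> Mt Md; rewrite -(derive_linmx trmx X Md).
exact: (eq_on_derive local_domain_open).
Qed.

(** The quantities squared on the left sides differ by the factor [kappa / c], up to sign. On the
    right sides the sectional curvature is common, and the vector [R(W, V) X] is [- kappa / c] times
    the tangential part of the structure applied to [X]. *)
Lemma compare_sides X Y :
  lhs_A scale phi p x j X Y W V = (kappa / c) ^+ 2 * lhs_B scale phi p x j X Y
    q /\
  rhs_A scale phi p x j X Y W V = (kappa / c) ^+ 2 * rhs_B scale phi p x j X Y
    q.
Proof.
pose Phi z := @affproj R K N j (f z).
have [dPsi dPsiE] : exists dPsi : 'rV[R]_(N.-1 * d) -> 'M[R]_(N * d),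
  forall xi, 'D_xi (@affproj R K N j) (f y) = dPsi xi by eexists.
have [dPhi dPhiE] : exists dPhi : 'rV[R]_n -> 'M[R]_(N * d),
  forall X, 'D_X Phi y = dPhi X by eexists.
have [ddPhi ddPhiE] : exists ddPhi : 'rV[R]_n -> 'rV[R]_n -> 'M[R]_(N * d),
  forall X Y, 'D_X ('D_Y Phi) y = ddPhi X Y by exists (fun X Y => 'D_X ('D_Y
    Phi) y).
have [df dfE] : exists df : 'rV[R]_n -> 'rV[R]_(N.-1 * d),
  forall X, 'D_X f y = df X by eexists.
have oU := local_domain_open.
have Psi2 := @affproj_smooth R K N j 2.
have f2 := local_map_smooth 2.
have Phi3 : class_C 3 U Phi := class_C_affproj_comp j oU (local_map_smooth 3).
have Phi2 := class_CW Phi3.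
have HE := fubini_studyE (K := K) j scale.
have Pinj xi : 'D_xi (@affproj R K N j) (f y) = 0 -> xi = 0 :=
  @derive_affproj_inj R K N j (f y) xi.
have finj X' : 'D_X' f y = 0 -> X' = 0.
  by have [_ h] := phi_imm; apply: (h p x j); split.
have PE z w : U z -> orthproj (fiber phi x z) w = opv (Phi z) w.
  by move=> Uz; rewrite fiber_local// orthproj_line// vec_neq0.
have PP z : U z -> Phi z *m Phi z = Phi z by move=> _; apply: projmx_idem;
  exact: vec_neq0.
have Ptr z : U z -> (Phi z)^T = Phi z by move=> _; exact: projmx_tr.
have Pkl z : U z -> klinear (Phi z) by move=> _; apply: projmx_klinear; exact:
  vec_neq0.
have Wfix e : opv (Phi y) (v *m rho e) = v *m rho e.
  by apply: projmx_id; [exact: vec_neq0|apply/kline_rho; exists e].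
have [Phid PhiD] := Phi2.
have Pd1 X' z : U z -> differentiable ('D_X' Phi) z by have [h _] := PhiD X';
  exact: h.
have dPhitr X' : (dPhi X')^T = dPhi X' by rewrite -dPhiE; apply:
  derive_fixed_tr Ptr (Phid y Uy).
have dPhikl X' : klinear (dPhi X') by rewrite -dPhiE; exact: derive_klinear _
  oU Uy Pkl (Phid y Uy).
have ddPhitr X' Y' : (ddPhi X' Y')^T = ddPhi X' Y'.
  rewrite -ddPhiE; apply: derive_fixed_tr (Pd1 Y' y Uy) => z Uz.
  exact: (derive_proj_tr oU Ptr Phi3 Y' Uz).
have ddPhikl X' Y' : klinear (ddPhi X' Y').
  rewrite -ddPhiE; apply: (derive_klinear _ oU Uy _ (Pd1 Y' y Uy)) => z Uz.
  exact: (derive_klinear _ oU Uz Pkl (Phid z Uz)).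
set G := base_metric scale phi x j.
have klB S S' : klinear S -> klinear S' -> klinear (S - S').
  by move=> Sl Sl' w e; rewrite !opvBl Sl Sl' mulmxBl.
have com S X' : klinear S /\ S^T = S -> commform S (dPhi X') W V =
    kappa * mxdot S (dPsi (span_structure q (df X'))).
  move=> [Sl St]; rewrite (dPhi_dPsi Uy f2 Psi2 dPsiE dPhiE dfE) -!dPsiE.
  exact: commform_span.
have II X' Y' : klinear (ddPhi X' Y' - dPhi (christoffel G y X' Y')) /\
    (ddPhi X' Y' - dPhi (christoffel G y X' Y'))^T = ddPhi X' Y' - dPhi
      (christoffel G y X' Y').
  by split; [exact: klB|rewrite linearB /= ddPhitr dPhitr].
have lA : mxdot (curvature_derivative (fiber phi x) G y X X Y W) V =
    kappa * (mxdot (ddPhi X X - dPhi (christoffel G y X X)) (dPsi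
      (span_structure q (df Y)))
    - mxdot (ddPhi X Y - dPhi (christoffel G y X Y)) (dPsi (span_structure q
      (df X)))).
  apply: etrans (curvature_derivative_proj oU PE PP Ptr Phi3 Uy dPhiE G ddPhiE
    (Wfix a) (Wfix b) X X Y) _.
  rewrite (commformC _ _ (dPhi X)); apply: etrans (congr2 (fun a b => a - b)
    (com _ Y (II X X)) (com _ X (II X Y))) _.
  by rewrite mulrBr.
have lB : G y (shape_operator H f y (norproj H f y (span_structure q (df X))) Y
     - shape_operator H f y (norproj H f y (span_structure q (df Y))) X) X =
    c * (mxdot (ddPhi Y X - dPhi (christoffel G y Y X)) (dPsi (span_structure q
      (df X)))
       - mxdot (ddPhi X X - dPhi (christoffel G y X X)) (dPsi (span_structure q
         (df Y)))).
  exact: (shape_operator_diff oU Uy f2 Psi2 Phi2 c_neq0 HE Pinj finj dPsiE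
    dPhiE ddPhiE dfE).
have span_df X' : span_structure q ('D_X' f y) = span_structure q (df X').
  by rewrite dfE.
have lB' := etrans (congr2 (fun u w => G y (shape_operator H f y (norproj H f y
  u) Y
  - shape_operator H f y (norproj H f y w) X) X) (span_df X) (span_df Y)) lB.
have GE' X' Y' : G y X' Y' = c * mxdot (dPhi X') (dPhi Y').
  exact: (pullback_metric_at Uy f2 Psi2 HE dPhiE).
have HE' xi eta : H (f y) xi eta = c * mxdot (dPsi xi) (dPsi eta).
  exact: (ambient_metric_at HE dPsiE).
have dPhil := dPhi_lin Uy f2 Psi2 dPsiE dPhiE dfE.
have dPhii := dPhi_inj Uy f2 Psi2 Pinj finj dPsiE dPhiE dfE.
have dPhiP := dPhi_dPsi Uy f2 Psi2 dPsiE dPhiE dfE.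
(* The two sides use the mixed second fundamental form with its arguments in opposite orders. *)
have sym : mxdot (ddPhi X Y - dPhi (christoffel G y X Y)) (dPsi (span_structure
  q (df X)))
    = mxdot (ddPhi Y X - dPhi (christoffel G y Y X)) (dPsi (span_structure q
      (df X))).
  have -> : ddPhi X Y = ddPhi Y X by exact: (ddPhiC oU Uy Phi2 ddPhiE).
  have -> // : christoffel G y X Y = christoffel G y Y X.
  exact: (christoffelC oU Uy f2 Psi2 Phi2 c_neq0 HE Pinj finj dPsiE dPhiE
    ddPhiE dfE).
have kc : kappa = kappa / c * c by rewrite divfK.
move: (kappa / c) kc => r kc.
split.
  apply: etrans (congr1 (fun z => z ^+ 2) lA) _.
  apply: etrans _ (esym (congr1 (fun z => r ^+ 2 * z ^+ 2) lB')).
  have alg (k c' a1 a2 a3 : R) : k = r * c' -> a2 = a3 ->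
      (k * (a1 - a2)) ^+ 2 = r ^+ 2 * (c' * (a3 - a1)) ^+ 2.
    by move=> -> ->; ring.
  exact: alg kc sym.
have [T TE TP] := tanproj_induced Uy f2 Psi2 c_neq0 HE Pinj finj dPsiE dPhiE dfE
  (span_structure q (df X)).
have lin0 k Z : dPhi (k *: Z) = k *: dPhi Z.
  have dPhi0 : dPhi 0 = 0.
    have h := dPhil 1 0 0; rewrite scaler0 addr0 scale1r in h.
    by apply: (addrI (dPhi 0)); rewrite addr0 -h.
  by have := dPhil k Z 0; rewrite dPhi0 !addr0.
(* The minus sign arises because [X] has to be moved to the second slot of the commutator, where
   [commform_span] turns it into the structure applied to [X]. *)
have dualE : curvature_dual (fiber phi x) G y W V X = - r *: T.
  have TD Z : G y (- r *: T) Z =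
      mxdot (curvature_tensor (fiber phi x) y X Z W) V.
    apply: etrans _ (esym (curvature_extension oU PE PP Ptr Phi3 Uy dPhiE
      (Wfix a) (Wfix b) X Z)).
    rewrite commformC (com _ X (conj (dPhikl Z) (dPhitr Z))) GE' lin0 mxdotZl
      TP.
    rewrite (mxdotC (dPhi Z)); have alg (k c' s : R) : k = r * c' ->
        c' * (- r * s) = - (k * s) by move=> ->; ring.
    exact: alg kc.
  apply: xget_unique; first exact: TD.
  move=> T' T'P.
  apply: (mxdot_image_inj dPhil dPhii) => Z; apply: (mulfI c_neq0).
  by apply: etrans (esym (GE' _ _)) (etrans (T'P Z) (etrans (esym (TD Z)) (GE'
    _ _))).
apply: etrans (congr1 (fun u => sectional G y X Y * G y u u) dualE) _.
apply: etrans _ (esym (congr1 (fun u => r ^+ 2 * (sectional G y X Y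
  * H (f y) (tanproj H f y u) (tanproj H f y u))) (span_df X))).
rewrite TE HE' GE' lin0 mxdotZl mxdotZr dPhiP.
have alg (k s c' e : R) : k * (c' * (- r * (- r * s))) = r ^+ 2 * (k * (c' *
  s)).
  by ring.
exact: alg.
Qed.

End Comparison.
End LocalPicture.

(** * Passage between pairs of vectors in a fiber and imaginary scalars *)

Section Equivalence.
Context {R : realType} {K : scalars} {N n : nat} {B : topologicalType}.
Variables (A : set (chart R n B)) (phi : B -> KP R K N) (scale : R).
Hypotheses (scale_gt0 : 0 < scale) (phi_imm : immersion A phi).
Variables (p : B) (x : chart R n B) (j : 'I_N).
Hypothesis pxj : charts_at A phi p x j.
Local Notation d := (dimK K).
Local Notation v := (@insert_row R K N j (kone K) (local_map phi x j (cmap x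
  p))).

Lemma line_chart w : line_of (phi p) w <-> exists a : 'rV[R]_d, w = v *m rho a.
Proof.
have [Ax px pj] := pxj.
have <- : fiber phi x (cmap x p) = line_of (phi p) by rewrite /fiber cmapK.
rewrite (fiber_local (j := j)); first exact: kline_rho.
by exists p.
Qed.

(** The factor is the square from [compare_sides]; it is positive because [t], [scale] and the
    spanning vector are nonzero. *)
Lemma compare_in_chart a b (q : 'rV[R]_(nimag K)) t : t != 0 ->
  rho a *m (rho b)^T - rho b *m (rho a)^T = t *: rho (imag q) ->
  exists2 r, 0 < r & forall X Y,
    lhs_A scale phi p x j X Y (v *m rho a) (v *m rho b) =
      r * lhs_B scale phi p x j X Y q /\
    rhs_A scale phi p x j X Y (v *m rho a) (v *m rho b) =
      r * rhs_B scale phi p x j X Y q.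
Proof.
move=> t0 abq; have [Ax px pj] := pxj.
eexists; last by move=> X Y; exact: (compare_sides phi_imm Ax scale_gt0 px pj
  abq).
have v0 : mxdot v v != 0 by rewrite mxdot_eq0 vec_neq0.
have d0 : 2 * d%:R != 0 :> R by rewrite mulf_neq0 ?pnatr_eq0.
have s0 := lt0r_neq0 scale_gt0.
rewrite exprn_even_gt0//=; apply: mulf_neq0.
  by apply: mulf_neq0 => //; apply: mulf_neq0; rewrite ?invr_eq0.
by rewrite invr_eq0; apply: mulf_neq0; rewrite ?invr_eq0.
Qed.

Lemma inequality_A_of_B X Y (W V : 'M[R]_(N, d)) :
  (forall q, lhs_B scale phi p x j X Y q <= rhs_B scale phi p x j X Y q) ->
  line_of (phi p) W -> line_of (phi p) V ->
  lhs_A scale phi p x j X Y W V <= rhs_A scale phi p x j X Y W V.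
Proof.
move=> hB /line_chart[a ->] /line_chart[b ->].
have [c [cE _ _]] := rho_commutator a b.
have n2 : 2 != 0 :> R by rewrite pnatr_eq0.
have [r r0 /(_ X Y)[-> ->]] := compare_in_chart n2 cE.
by rewrite ler_pM2l.
Qed.

Lemma inequality_B_of_A X Y (q : 'rV[R]_(nimag K)) :
  (forall W V, line_of (phi p) W -> line_of (phi p) V ->
     lhs_A scale phi p x j X Y W V <= rhs_A scale phi p x j X Y W V) ->
  lhs_B scale phi p x j X Y q <= rhs_B scale phi p x j X Y q.
Proof.
move=> hA; have n2 : 2 != 0 :> R by rewrite pnatr_eq0.
(* To reach a given structure [q], take [W = v q] and [V = v]. *)
have E : rho (imag q) *m (rho (kone K))^T - rho (kone K) *m (rho (imag q))^T
    = 2 *: rho (imag q).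
  by rewrite rho1 trmx1 mulmx1 mul1mx rho_imag_tr opprK scaler_nat mulr2n.
have [r r0 /(_ X Y)[lE rE]] := compare_in_chart n2 E.
have in_line a : line_of (phi p) (v *m rho a) by apply/line_chart; exists a.
have := hA _ _ (in_line (imag q)) (in_line (kone K)).
by rewrite lE rE ler_pM2l.
Qed.

Lemma strict_A_of_B X Y (W V : 'M[R]_(N, d)) :
  (forall q, mxdot q q = 1 ->
     lhs_B scale phi p x j X Y q < rhs_B scale phi p x j X Y q) ->
  line_of (phi p) W -> line_of (phi p) V -> orthonormal_pair mxdot W V ->
  lhs_A scale phi p x j X Y W V < rhs_A scale phi p x j X Y W V.
Proof.
move=> hB /line_chart[a ->] /line_chart[b ->] [].
have v0 : mxdot v v != 0 by rewrite mxdot_eq0 vec_neq0.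
rewrite !mxdot_rho => aa bb /eqP; rewrite mulf_eq0 (negbTE v0) orbF => /eqP ab.
have [c [cE c0 cc]] := rho_commutator a b.
(* Orthonormality of the two vectors makes [c] purely imaginary of norm [1 / |v|^2], so multiplying
   by [|v|^2] gives a unit structure. *)
have q1 : mxdot (mxdot v v *: impart c) (mxdot v v *: impart c) = 1.
  rewrite -mxdot_imag imagZ mxdotZl mxdotZr.
  have := impartK c; rewrite c0 ab scale0r add0r => <-.
  by rewrite cc mulrA mulrACA [_ * mxdot a a]mulrC aa mul1r mulrC bb.
have tE : rho a *m (rho b)^T - rho b *m (rho a)^T =
    (2 / mxdot v v) *: rho (imag (mxdot v v *: impart c)).
  by rewrite cE imagZ rhoZ scalerA divfK.
have t0 : 2 / mxdot v v != 0 by rewrite mulf_neq0 ?invr_eq0 ?pnatr_eq0.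
have [r r0 /(_ X Y)[-> ->]] := compare_in_chart t0 tE.
by rewrite ltr_pM2l// hB.
Qed.

Lemma strict_B_of_A X Y (q : 'rV[R]_(nimag K)) :
  (forall W V, line_of (phi p) W -> line_of (phi p) V -> orthonormal_pair mxdot
    W V ->
     lhs_A scale phi p x j X Y W V < rhs_A scale phi p x j X Y W V) ->
  mxdot q q = 1 ->
  lhs_B scale phi p x j X Y q < rhs_B scale phi p x j X Y q.
Proof.
move=> hA q1.
have v0 : 0 < mxdot v v by rewrite mxdot_gt0 vec_neq0.
(* Normalizing [v] makes [v q / |v|] and [v / |v|] orthonormal, as [q] is a unit and imaginary
   scalars are orthogonal to 1. *)
pose s := (Num.sqrt (mxdot v v))^-1.
have ss : s * s * mxdot v v = 1.
  by rewrite -expr2 exprVn sqr_sqrtr ?ltW// mulVf ?gt_eqF.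
have s0 : s != 0 by rewrite invr_eq0 gt_eqF// sqrtr_gt0.
have E : rho (s *: imag q) *m (rho (s *: kone K))^T
    - rho (s *: kone K) *m (rho (s *: imag q))^T = (2 * (s * s)) *: rho (imag
      q).
  rewrite !rhoZ rho1 !linearZ /= trmx1 -?scalemxAl -?scalemxAr mulmx1 mul1mx.
  by rewrite rho_imag_tr !scalerN opprK !scalerA -scalerDl -mulr2n mulr_natl.
have t0 : 2 * (s * s) != 0 by rewrite !mulf_neq0 ?pnatr_eq0.
have k1 : mxdot (kone K) (kone K) = 1 :> R by exact: mxdot_delta.
have qk : mxdot (imag q) (kone K) = 0.
  rewrite mxdotE big_ord1 (bigD1 ord0)//= imag0 mul0r add0r big1// => l l0.
  by rewrite !mxE (negbTE l0) mulr0.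
have [r r0 /(_ X Y)[lE rE]] := compare_in_chart t0 E.
have in_line a : line_of (phi p) (v *m rho a) by apply/line_chart; exists a.
suff on : orthonormal_pair mxdot (v *m rho (s *: imag q)) (v *m rho (s *: kone
  K)).
  have := hA _ _ (in_line (s *: imag q)) (in_line (s *: kone K)) on.
  by rewrite lE rE ltr_pM2l.
split; rewrite mxdot_rho mxdotZl mxdotZr ?mulrA.
- by rewrite mxdot_imag q1 mulr1.
- by rewrite k1 mulr1.
- by rewrite qk mulr0 mul0r.
Qed.

End Equivalence.

Theorem theorem1p8 (R : realType) (K : scalars) (N n : nat)
    (B : topologicalType) (A : set (chart R n B)) (phi : B -> KP R K N)
    (scale : R) (scale_gt0 : 0 < scale)
    (B_manifold : compact_manifold A) (phi_immersion : immersion A phi) :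
  ((forall p x j, charts_at A phi p x j ->
      forall (X Y : 'rV[R]_n) (W V : 'M[R]_(N, dimK K)),
        line_of (phi p) W -> line_of (phi p) V ->
        lhs_A scale phi p x j X Y W V <= rhs_A scale phi p x j X Y W V)
   <->
   (forall p x j, charts_at A phi p x j ->
      forall (X Y : 'rV[R]_n) (a : 'rV[R]_(nimag K)),
        lhs_B scale phi p x j X Y a <= rhs_B scale phi p x j X Y a))
  /\
  ((forall p x j, charts_at A phi p x j ->
      forall (X Y : 'rV[R]_n) (W V : 'M[R]_(N, dimK K)),
        line_of (phi p) W -> line_of (phi p) V ->
        orthonormal_pair (base_metric scale phi x j (cmap x p)) X Y ->
        orthonormal_pair mxdot W V ->
        lhs_A scale phi p x j X Y W V < rhs_A scale phi p x j X Y W V)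
   <->
   (forall p x j, charts_at A phi p x j ->
      forall (X Y : 'rV[R]_n) (a : 'rV[R]_(nimag K)),
        orthonormal_pair (base_metric scale phi x j (cmap x p)) X Y ->
        mxdot a a = 1 ->
        lhs_B scale phi p x j X Y a < rhs_B scale phi p x j X Y a)).
Proof.
split; split=> h p x j pxj X Y.
- move=> q; apply: (inequality_B_of_A scale_gt0 phi_immersion pxj) => W V.
  exact: h.
- move=> W V; apply: (inequality_A_of_B scale_gt0 phi_immersion pxj) => q.
  exact: h.
- move=> q XY; apply: (strict_B_of_A scale_gt0 phi_immersion pxj) => W V Wp Vp.
  exact: h.
- move=> W V Wp Vp XY; apply: (strict_A_of_B scale_gt0 phi_immersion pxj) => //.
  by move=> q; exact: h.
Qed.
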